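(* Let $m\ge 1$, let $\Omega\subset\mathbb{R}^m$ be a convex open set, and let $X$ be a complex manifold equipped with a metric $d$ inducing its topology. Let $F$ be a holomorphic mapping of the tube $T_\Omega=\{z=x+iy:\ x\in\mathbb{R}^m,\ y\in\Omega\}\subset\mathbb{C}^m$ to $X$ such that for every compact subset $K\subset\Omega$ the mapping $F$ is uniformly continuous on $T_K=\{x+iy:\ x\in\mathbb{R}^m,\ y\in K\}$ and $F(T_K)$ is a relatively compact subset of $X$. If for some $y'\in\Omega$ the restriction of $F$ to $\mathbb{R}^m+iy'$ is almost periodic, then $F$ is an almost periodic mapping of $T_\Omega$ to $X$.
   Context: For a set $K\subset\mathbb{R}^m$ let $T_K=\{z=x+iy:\ x\in\mathbb{R}^m,\ y\in K\}\subset\mathbb{C}^m$. A continuous mapping $F$ of $T_K$ to a metric space $(X,d)$ is called almost periodic if the family of shifts $\{F(z+t)\}_{t\in\mathbb{R}^m}$ is relatively compact (in the space of continuous mappings from $T_K$ to $X$) with respect to the topology of uniform convergence on $T_K$; that is, every sequence $(t_n)\subset\mathbb{R}^m$ has a subsequence along which $F(z+t_n)$ converges uniformly on $T_K$ to a continuous mapping from $T_K$ to $X$. In particular, with $K=\{y'\}$ this defines almost periodicity of the restriction of $F$ to $\mathbb{R}^m+iy'$. For a convex open set $\Omega\subset\mathbb{R}^m$, a holomorphic mapping $F$ of $T_\Omega$ to a complex manifold $X$ is called almost periodic if for every compact $K\subset\Omega$ the restriction of $F$ to $T_K$ is almost periodic as a continuous mapping of $T_K$ to the metric space $(X,d)$,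 i.e. the family of shifts $\{F(z+t)\}_{t\in\mathbb{R}^m}$ is relatively compact with respect to the topology of uniform convergence on $T_K$. Uniform continuity and uniform convergence are with respect to the Euclidean metric on $T_K$ and the metric $d$ on $X$. *)

(* Defs.v *)
From HB Require Import structures.
From mathcomp Require Import all_boot all_order all_algebra complex.
From mathcomp Require Import all_classical all_reals all_analysis.

Set Implicit Arguments.
Unset Strict Implicit.
Unset Printing Implicit Defensive.

Import Order.TTheory GRing.Theory Num.Theory.
Import numFieldNormedType.Exports.

Local Open Scope classical_set_scope.
Local Open Scope ring_scope.

(* R[i] gets the topology of its modulus, so that 'rV[R[i]]_m, with the sup
   norm, is C^m as a normed space over R[i]. *)
#[non_forgetful_inheritance]
HB.instance Definition _ (R : realType) := NormedModule.copy R[i] R[i]^o.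

Section ComplexManifold.
Context {R : realType}.

(* Frechet differentiability over R[i], at every point of U; meant for open U,
   the values of f outside of U being then irrelevant. *)
Definition holomorphic_on {m n : nat} (U : set 'rV[R[i]]_m)
    (f : 'rV[R[i]]_m -> 'rV[R[i]]_n) : Prop :=
  forall z, U z -> differentiable f z.

(* The two maps are total functions, relevant only on chart_dom and
   chart_cod, which they identify homeomorphically. *)
Record chart (n : nat) (X : topologicalType) := Chart {
  chart_dom : set X ;
  chart_cod : set 'rV[R[i]]_n ;
  chart_map : X -> 'rV[R[i]]_n ;
  chart_inv : 'rV[R[i]]_n -> X ;
  chart_dom_open : open chart_dom ;
  chart_cod_open : open chart_cod ;
  chart_mapP : forall p, chart_dom p -> chart_cod (chart_map p) ;
  chart_invP : forall v, chart_cod v -> chart_dom (chart_inv v) ;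
  chart_mapK : forall p, chart_dom p -> chart_inv (chart_map p) = p ;
  chart_invK : forall v, chart_cod v -> chart_map (chart_inv v) = v ;
  chart_map_continuous : {within chart_dom, continuous chart_map} ;
  chart_inv_continuous : {within chart_cod, continuous chart_inv} }.

(* An n-dimensional complex manifold is a topological space X with such an
   atlas. X is used below with a metric, hence Hausdorff; second countability
   is not imposed. *)
Record complex_atlas (n : nat) (X : topologicalType) := ComplexAtlas {
  atlas : set (chart n X) ;
  atlas_cover : forall p : X, exists2 c, atlas c & chart_dom c p ;
  atlas_compat : forall c c', atlas c -> atlas c' ->
    holomorphic_on
      (chart_cod c `&` chart_inv c @^-1` chart_dom c')
      (chart_map c' \o chart_inv c) }.

Definition holomorphic_map {m n : nat} {X : topologicalType}
    (M : complex_atlas n X) (U : set 'rV[R[i]]_m)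
    (F : 'rV[R[i]]_m -> X) : Prop :=
  {within U, continuous F} /\
  forall c, atlas M c ->
    holomorphic_on (U `&` F @^-1` chart_dom c) (chart_map c \o F).

End ComplexManifold.

Arguments chart R n X : clear implicits.
Arguments complex_atlas R n X : clear implicits.

Section AlmostPeriodic.
Context {R : realType} {m : nat}.

Definition tube (K : set 'rV[R]_m) : set 'rV[R[i]]_m :=
  [set map2_mx (@Complex R) x y | x in [set: 'rV[R]_m] & y in K].

Definition euclidean_dist (z w : 'rV[R[i]]_m) : R :=
  Num.sqrt (\sum_(j < m) (complex.Re (z ord0 j - w ord0 j) ^+ 2 +
                          complex.Im (z ord0 j - w ord0 j) ^+ 2)).

Definition uniformly_continuous_on {X : metricType R} (A : set 'rV[R[i]]_m)
    (F : 'rV[R[i]]_m -> X) : Prop :=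
  forall e : R, 0 < e -> exists2 d : R, 0 < d &
    forall z w, A z -> A w -> euclidean_dist z w < d -> mdist (F z) (F w) < e.

Definition real_shift {X : Type} (F : 'rV[R[i]]_m -> X) (t : 'rV[R]_m) :
    'rV[R[i]]_m -> X :=
  fun z => F (z + map_mx (real_complex R) t).

(* Relative compactness of the family of shifts, for uniform convergence on
   tube K, expressed with sequences; s selects the subsequence. *)
Definition almost_periodic_on {X : metricType R} (K : set 'rV[R]_m)
    (F : 'rV[R[i]]_m -> X) : Prop :=
  {within tube K, continuous F} /\
  forall t : nat -> 'rV[R]_m,
    exists (s : nat -> nat) (G : 'rV[R[i]]_m -> X),
      [/\ {homo s : i j / (i < j)%N},
          {within tube K, continuous G} &
          {uniform tube K, (fun k => real_shift F (t (s k))) @ \oo --> G}].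

Definition almost_periodic_map {n : nat} {X : metricType R}
    (M : complex_atlas R n X) (Omega : set 'rV[R]_m)
    (F : 'rV[R[i]]_m -> X) : Prop :=
  holomorphic_map M (tube Omega) F /\
  forall K : set 'rV[R]_m, compact K -> K `<=` Omega -> almost_periodic_on K F.

End AlmostPeriodic.

(* Main.v *)
(* The point is that closeness of two real translates of F propagates: if
   F(z + t) and F(z + t') are uniformly close on R^m + iy', then they are close on
   R^m + iy for every y in Omega, with a modulus independent of t and t'. Hence
   a sequence of shifts that is uniformly Cauchy on R^m + iy' is uniformly Cauchy
   on every T_K, and F(T_K) lies in a compact set, so it converges.

   The complex lines w |-> x + iy' + w (y - y'), which map the real axis into
   R^m + iy' and i + R into R^m + iy, reduce the propagation to one variable. By
   uniform continuity and compactness small squares are mapped into a single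
   chart, and in a chart the difference f of the two maps is small on the bottom
   side of the square. The product of the four rotations of f about the centre is
   then small on the whole boundary, hence at the centre, where it equals f^4.
   The estimate at the centre is Cauchy's theorem (by Goursat's bisection)
   applied to f(z)/z. Finitely many steps of fixed length climb from y' to y. *)
Require Import Defs.
From mathcomp Require Import all_boot all_order all_algebra complex ring lra.
From mathcomp Require Import all_classical all_reals all_analysis.
Import Order.TTheory GRing.Theory Num.Theory.
Import numFieldNormedType.Exports.
Set Implicit Arguments.
Unset Strict Implicit.
Unset Printing Implicit Defensive.
Local Open Scope classical_set_scope.
Local Open Scope ring_scope.
Local Open Scope complex_scope.
Local Notation Re := complex.Re.
Local Notation Im := complex.Im.

(** * Differentiability of functions of one variable over a numeric field *)

Section Differentiable.
Variable K : numFieldType.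
Implicit Types (f g : K -> K) (z c j : K).
Lemma differentiable_mull_arg f (j z : K) : differentiable f (j * z) ->
  differentiable (fun w => f (j * w)) z.
Proof.
by move=> h; apply: (@differentiable_comp _ _ _ _ (fun w => j * w) f) => //.
Qed.

Lemma differentiable_mulf f g (z : K) : differentiable f z -> differentiable g z ->
  differentiable (fun w => f w * g w) z.
Proof. by move=> df dg; apply: differentiableM. Qed.

Lemma differentiable_subf f g (z : K) : differentiable f z -> differentiable g z ->
  differentiable (fun w => f w - g w) z.
Proof. by move=> df dg; apply: differentiableB. Qed.

Lemma differentiable_divid g (z : K) : z != 0 -> differentiable g z ->
  differentiable (fun w => g w / w) z.
Proof.
by move=> z0 dg; apply: differentiableM => //; apply: differentiableV.
Qed.

Lemma differentiable_expansion g z : differentiable g z -> exists d, forall e, 0 < e ->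
  exists2 r, 0 < r & forall h, `|h| < r -> `|g (z + h) - g z - d * h| <= e * `|h|.
Proof.
move=> /derivable1_diffP /cvg_ex [l hl]; exists l => e e0.
have /cvgrPdist_le /(_ e e0) := hl.
move=> /nbhs_ballP [r /= r0 H]; exists r => // h hr.
have [->|h0] := eqVneq h 0; first by rewrite addr0 subrr mulr0 subr0 normr0 mulr0.
have := H h; rewrite /ball /= sub0r normrN => /(_ hr h0).
rewrite distrC => H2.
rewrite -(ler_pM2r (_ : 0 < `|h|)) ?normr_gt0// in H2.
apply: le_trans H2; rewrite -normrM mulrBl.
by rewrite -[_ *: _]/(_ * _) mulrAC mulVf// mul1r [h%:A]mulr1 [h + z]addrC.
Qed.

Lemma differentiable_eps_continuous g z : differentiable g z -> forall e, 0 < e ->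
  exists2 r, 0 < r & forall h, `|h| < r -> `|g (z + h) - g z| < e.
Proof.
move=> /differentiable_continuous /= hc e e0.
have /cvgrPdist_lt /(_ e e0) /nbhs_ballP [r /= r0 H] := hc; exists r => // h hr.
by rewrite distrC; apply: H; rewrite /ball /= opprD addNKr normrN.
Qed.
End Differentiable.

(** * Integrals over segments *)

Section Integral.
Context {R : realType}.
Implicit Types (f g : R -> R) (a b c : R).

Definition segint f a b : R := \int[lebesgue_measure]_(x in `[a, b]) f x.
(** Two-sided continuity even at the endpoints: the integrands come from functions continuous in the
    plane at each point of an edge, so no subspace topology enters. *)
Definition cont_on f a b := forall x, a <= x <= b -> {for x, continuous f}.

Lemma cont_on_integrable f a b : cont_on f a b ->
  lebesgue_measure.-integrable `[a, b] (EFin \o f).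
Proof.
move=> fab; apply: continuous_compact_integrable; first exact: segment_compact.
apply: continuous_in_subspaceT => x; rewrite inE /= in_itv /=; exact: fab.
Qed.

Lemma segint_ext f g a b : (forall x, a <= x <= b -> f x = g x) -> segint f a b = segint g a b.
Proof. by move=> fg; apply: eq_Rintegral => x; rewrite inE /= in_itv /=; exact: fg. Qed.

Lemma segint_add f g a b : cont_on f a b -> cont_on g a b ->
  segint (fun x => f x + g x) a b = segint f a b + segint g a b.
Proof. by move=> fab gab; apply: RintegralD => //; exact: cont_on_integrable. Qed.

Lemma segint_scale (k : R) f a b : cont_on f a b ->
  segint (fun x => k * f x) a b = k * segint f a b.
Proof. by move=> fab; apply: RintegralZl => //; exact: cont_on_integrable. Qed.

Lemma segint_cst (k : R) a b : a <= b -> segint (fun=> k) a b = k * (b - a).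
Proof.
move=> ab; rewrite /segint Rintegral_cst//= lebesgue_measure_itv /= lte_fin.
by move: ab; rewrite le_eqVlt => /predU1P[->|->//]; rewrite ltxx subrr.
Qed.

Lemma cont_on_cst (k : R) a b : cont_on (fun=> k) a b.
Proof. by move=> x _; exact: cvg_cst. Qed.

Lemma cont_on_scale (k : R) f a b : cont_on f a b -> cont_on (fun x => k * f x) a b.
Proof. by move=> F x xab; apply: cvgM; [exact: cvg_cst|exact: F]. Qed.

Lemma cont_on_id a b : cont_on id a b.
Proof. by move=> x _; exact: cvg_id. Qed.

Lemma segint_le f g a b : cont_on f a b -> cont_on g a b ->
  (forall x, a <= x <= b -> f x <= g x) -> segint f a b <= segint g a b.
Proof.
move=> F G fg; by apply: le_Rintegral => //; try exact: cont_on_integrable.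
Qed.

Lemma segint_ge_cst (k : R) f a b : a <= b -> cont_on f a b ->
  (forall x, a <= x <= b -> k <= f x) -> k * (b - a) <= segint f a b.
Proof. by move=> ab F h; rewrite -segint_cst//; apply: segint_le => //; exact: cont_on_cst. Qed.

Lemma segint_le_cst (k : R) f a b : a <= b -> cont_on f a b ->
  (forall x, a <= x <= b -> f x <= k) -> segint f a b <= k * (b - a).
Proof. by move=> ab F h; rewrite -segint_cst//; apply: segint_le => //; exact: cont_on_cst. Qed.

Lemma segint_cat f a b c : a <= b -> b <= c -> cont_on f a c ->
  segint f a c = segint f a b + segint f b c.
Proof.
move=> ab bc F; have I := cont_on_integrable F.
apply/eqP; rewrite addrC -subr_eq; apply/eqP; rewrite /segint.
rewrite (@Rintegral_itvB _ _ _ _ b I)/= ?bnd_simp//.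
apply: Rintegral_itv_obnd_cbnd; apply: integrableS I => //.
by move=> x /=; rewrite !in_itv /= => /andP[/ltW bx ->]; rewrite (le_trans ab bx).
Qed.

Lemma segint_id a b : a <= b -> segint id a b = (b ^+ 2 - a ^+ 2) / 2.
Proof.
rewrite le_eqVlt => /predU1P[->|ab].
  by rewrite subrr mul0r /segint set_itv1 Rintegral_set1.
rewrite /segint /Rintegral (@continuous_FTC2 _ id (fun x => x ^+ 2 / 2) a b)//=.
- by rewrite mulrBl.
- by apply: continuous_in_subspaceT => x _; exact: cvg_id.
- split => //.
  + by apply: cvg_at_right_filter; apply: cvgM; [exact: exprn_continuous|exact: cvg_cst].
  + by apply: cvg_at_left_filter; apply: cvgM; [exact: exprn_continuous|exact: cvg_cst].
- move=> x _; rewrite derive1E.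
  have H : is_derive x 1 (fun x : R => x ^+ 2 / 2) x.
    apply: is_derive_eq.
    by rewrite !scaler0 add0r [x%:A]mulr1 -[LHS]/(2^-1 * (x + x)) mulrC mulrDl -splitr.
  by have [_ ->] := H.
Qed.
End Integral.

(** * Bisection of rectangles *)

Section Bisection.
Context {R : realType}.

(** The supremum of the left ends works, since every left end lies below every right end. *)
Lemma nested_point (a : nat -> R) (w : R) : 0 <= w ->
  (forall n, a n <= a n.+1) ->
  (forall n, a n.+1 + w / 2 ^+ n.+1 <= a n + w / 2 ^+ n) ->
  exists p, forall n, a n <= p <= a n + w / 2 ^+ n.
Proof.
move=> w0 ainc bdec.
have wn n : 0 <= w / 2 ^+ n by rewrite divr_ge0// exprn_ge0.
have mono m n : (m <= n)%N -> a m <= a n.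
  by move/nondecreasing_seqP : ainc; exact.
have bmono m n : (m <= n)%N -> a n + w / 2 ^+ n <= a m + w / 2 ^+ m.
  by move/(nonincreasing_seqP (fun n => a n + w / 2 ^+ n)) : bdec; exact.
have up m n : a m <= a n + w / 2 ^+ n.
  case: (leqP m n) => [mn|/ltnW nm].
    by rewrite (le_trans (mono _ _ mn))// lerDl.
  by apply: le_trans (bmono _ _ nm); rewrite lerDl.
exists (sup (range a)) => n; apply/andP; split.
  apply: ub_le_sup; last by exists n.
  by exists (a 0%N + w / 2 ^+ 0) => _ [m _ <-]; exact: up.
by apply: ge_sup => [|_ [m _ <-]]; [exists (a 0%N); exists 0%N|exact: up].
Qed.

(** By contradiction: a rectangle failing [P] has a quarter failing [P]. The nested quarters shrink
    to a point (p, q), where the local hypothesis forces [P] on all small rectangles around it. *)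
Lemma rect_bisect (P : R -> R -> R -> R -> Prop) (a0 b0 c0 d0 : R) :
  a0 <= b0 -> c0 <= d0 ->
  (forall a b c d, a <= b -> c <= d ->
     a0 <= a -> b <= b0 -> c0 <= c -> d <= d0 ->
     let m := (a + b) / 2 in let n := (c + d) / 2 in
     P a m c n -> P m b c n -> P a m n d -> P m b n d -> P a b c d) ->
  (forall p q, a0 <= p <= b0 -> c0 <= q <= d0 ->
     exists2 r, 0 < r & forall a b c d, a <= p <= b -> c <= q <= d ->
       a0 <= a -> b <= b0 -> c0 <= c -> d <= d0 -> b - a < r -> d - c < r -> P a b c d) ->
  P a0 b0 c0 d0.
Proof.
move=> ab cd hsplit hloc.
pose w := b0 - a0; pose h := d0 - c0.
have w0 : 0 <= w by rewrite subr_ge0.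
have h0 : 0 <= h by rewrite subr_ge0.
(* Only the lower left corner is stored; after n bisections the sides are w / 2^n and h / 2^n. *)
pose bad n (s : R * R) := [/\ a0 <= s.1, s.1 + w / 2 ^+ n <= b0, c0 <= s.2, s.2 + h / 2 ^+ n <= d0
  & ~ P s.1 (s.1 + w / 2 ^+ n) s.2 (s.2 + h / 2 ^+ n)].
apply: contrapT => bad0.
pose nxt n (s t : R * R) := [/\ s.1 <= t.1, t.1 + w / 2 ^+ n.+1 <= s.1 + w / 2 ^+ n,
  s.2 <= t.2 & t.2 + h / 2 ^+ n.+1 <= s.2 + h / 2 ^+ n].
have half (x : R) n : x / 2 ^+ n = x / 2 ^+ n.+1 + x / 2 ^+ n.+1.
  by rewrite exprS invfM; set t := (2 ^+ n)^-1; field.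
have step n s : bad n s -> exists t, bad n.+1 t /\ nxt n s t.
  case: s => x y [/= xa xb yc yd nP].
  have wn : 0 <= w / 2 ^+ n.+1 by rewrite divr_ge0// exprn_ge0.
  have hn : 0 <= h / 2 ^+ n.+1 by rewrite divr_ge0// exprn_ge0.
  have ew := half w n; have eh := half h n.
  rewrite ew addrA in xb nP; rewrite eh addrA in yd nP.
  set w' := w / 2 ^+ n.+1 in wn ew xb nP *; set h' := h / 2 ^+ n.+1 in hn eh yd nP *.
  apply: contrapT => /forallNP nt; apply: nP.
  have mE : (x + (x + w' + w')) / 2 = x + w' by lra.
  have nE : (y + (y + h' + h')) / 2 = y + h' by lra.
  have := hsplit x (x + w' + w') y (y + h' + h').
  rewrite /= mE nE; apply; try lra; apply: contrapT => nP.
  - by apply: (nt (x, y)); split; split => //=; rewrite -/w' -/h' ?ew ?eh; lra.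
  - by apply: (nt (x + w', y)); split; split => //=; rewrite -/w' -/h' ?ew ?eh; lra.
  - by apply: (nt (x, y + h')); split; split => //=; rewrite -/w' -/h' ?ew ?eh; lra.
  - by apply: (nt (x + w', y + h')); split; split => //=; rewrite -/w' -/h' ?ew ?eh; lra.
(* A total function of the pair (n, corner) is chosen; corners that are not bad are sent to
   themselves. *)
have /choice [F HF] : forall ns : nat * (R * R), exists t,
    bad ns.1 ns.2 -> bad ns.1.+1 t /\ nxt ns.1 ns.2 t.
  move=> [n s]; have [bs|nbs] := pselect (bad n s); last by exists s.
  by have [t ?] := step n s bs; exists t.
pose u := fix u n := if n is m.+1 then F (m, u m) else (a0, c0).
have ea : a0 + w / 2 ^+ 0 = b0 by rewrite expr0 divr1 addrC subrK.
have ec : c0 + h / 2 ^+ 0 = d0 by rewrite expr0 divr1 addrC subrK.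
have badu n : bad n (u n).
  elim: n => [|n ih]; last by have [] := HF (n, u n) ih.
  by split => //=; rewrite ?ea ?ec.
have nxtu n : nxt n (u n) (u n.+1) by have [] := HF (n, u n) (badu n).
have [p Hp] : exists p, forall n, (u n).1 <= p <= (u n).1 + w / 2 ^+ n.
  by apply: nested_point => // n; have [] := nxtu n.
have [q Hq] : exists p, forall n, (u n).2 <= p <= (u n).2 + h / 2 ^+ n.
  by apply: nested_point => // n; have [] := nxtu n.
have [] := hloc p q.
- by have := Hp 0%N; rewrite /= ea.
- by have := Hq 0%N; rewrite /= ec.
move=> r r0 Hr.
have [n Hn] : exists n, (w + h + 1) / 2 ^+ n < r.
  exists (Num.bound ((w + h + 1) / r)).
  by rewrite ltr_pdivrMr ?exprn_gt0// mulrC -ltr_pdivrMr//; exact: upper_nthrootP.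
have [xa xb yc yd] := badu n; apply.
have n2 : 0 < (2 ^+ n)^-1 :> R by rewrite invr_gt0 exprn_gt0.
by apply: Hr => //; rewrite addrAC subrr add0r; apply: le_lt_trans Hn; rewrite ler_pM2r//; lra.
Qed.
End Bisection.

(** * Cauchy's theorem for rectangles *)

Section Modulus.
Context {R : realType}.
Implicit Types (z w : R[i]).

(** The real-valued modulus: the norm [|z|] is itself an element of [R[i]]. *)
Definition cmod z : R := ComplexField.Normc.normc z.

Lemma cmodE z : `|z| = (cmod z)%:C.
Proof. by case: z => a b; rewrite normc_def. Qed.

Lemma cmod_ge0 z : 0 <= cmod z.
Proof. by case: z => a b; exact: sqrtr_ge0. Qed.

Lemma cmod_add z w : cmod (z + w) <= cmod z + cmod w.
Proof. exact: le_normcD. Qed.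

Lemma cmod_opp z : cmod (- z) = cmod z.
Proof. exact: normcN. Qed.

Lemma cmod_mul z w : cmod (z * w) = cmod z * cmod w.
Proof. exact: ComplexField.Normc.normcM. Qed.

Lemma cmod_distC z w : cmod (z - w) = cmod (w - z).
Proof. by rewrite -cmod_opp opprB. Qed.

Lemma cmod_real (x : R) : cmod x%:C = `|x|.
Proof. by rewrite /cmod /= expr0n /= addr0 sqrtr_sqr. Qed.

Lemma Re_le_cmod z : `|Re z| <= cmod z.
Proof. by case: z => a b; rewrite /cmod /= -sqrtr_sqr ler_wsqrtr// lerDl sqr_ge0. Qed.

Lemma Im_le_cmod z : `|Im z| <= cmod z.
Proof. by case: z => a b; rewrite /cmod /= -sqrtr_sqr ler_wsqrtr// lerDr sqr_ge0. Qed.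

Lemma cmod_le_ReIm z : cmod z <= `|Re z| + `|Im z|.
Proof.
case: z => a b; rewrite /cmod /= -(@ler_pXn2r _ 2) ?nnegrE ?sqrtr_ge0 ?addr_ge0//.
rewrite sqr_sqrtr ?addr_ge0 ?sqr_ge0// sqrrD !real_normK ?num_real//.
by rewrite addrAC lerDl mulrn_wge0// mulr_ge0.
Qed.

Lemma cmod_im (y : R) : cmod (0 +i* y) = `|y|.
Proof. by rewrite /cmod /= expr0n /= add0r sqrtr_sqr. Qed.
End Modulus.

Section Holomorphic.
Context {R : realType}.
Implicit Types (k g : R[i] -> R[i]) (z : R[i]).

Definition ccont_at k z := forall e : R, 0 < e ->
  exists2 r : R, 0 < r & forall h, cmod h < r -> cmod (k (z + h) - k z) < e.
Definition cdiff_at k z := exists d : R[i], forall e : R, 0 < e ->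
  exists2 r : R, 0 < r & forall h, cmod h < r ->
    cmod (k (z + h) - k z - d * h) <= e * cmod h.

Lemma gt0_complex_real (e : R[i]) : 0 < e -> exists2 r : R, 0 < r & e = r%:C.
Proof. by case: e => a b; rewrite ltcE /= => /andP[/eqP b0 a0]; exists a; rewrite ?b0. Qed.

Lemma differentiable_cdiff k z : differentiable k z -> cdiff_at k z.
Proof.
move=> /differentiable_expansion [d Hd]; exists d => e e0.
have eC : 0 < e%:C :> R[i] by rewrite ltcR.
have [r /gt0_complex_real[s s0 ->] H] := Hd _ eC; exists s => // h hs.
by have := H h; rewrite !cmodE ltcR -rmorphM lecR; apply.
Qed.

Lemma differentiable_ccont k z : differentiable k z -> ccont_at k z.
Proof.
move=> /differentiable_eps_continuous Hd e e0.
have eC : 0 < e%:C :> R[i] by rewrite ltcR.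
have [r /gt0_complex_real[s s0 ->] H] := Hd _ eC; exists s => // h hs.
by have := H h; rewrite !cmodE !ltcR; apply.
Qed.

(** Here [l] runs along a horizontal or vertical line and [p] is a real or imaginary part; both are
    contractions, so continuity in the plane passes to the integrand on an edge. *)
Lemma ccont_real (k : R[i] -> R[i]) (l : R -> R[i]) (p : R[i] -> R) (x : R) :
  (forall z w, `|p z - p w| <= cmod (z - w)) ->
  (forall y, cmod (l y - l x) <= `|y - x|) ->
  ccont_at k (l x) -> {for x, continuous (fun y => p (k (l y)))}.
Proof.
move=> Hp Hl ck; apply/cvgrPdist_lt => e e0.
have [r r0 H] := ck e e0.
near=> y; rewrite distrC; apply: le_lt_trans (Hp _ _) _.
have -> : l y = l x + (l y - l x) by rewrite addrC subrK.
apply: H; apply: le_lt_trans (Hl y) _.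
near: y; apply/nbhs_ballP; exists r => // y; by rewrite /ball /= distrC.
Unshelve. all: by end_near. Qed.

Lemma Re_contract z w : `|Re z - Re w| <= cmod (z - w).
Proof. by case: z w => a b [c d]; exact: (@Re_le_cmod R ((a +i* b) - (c +i* d))). Qed.

Lemma Im_contract z w : `|Im z - Im w| <= cmod (z - w).
Proof. by case: z w => a b [c d]; exact: (@Im_le_cmod R ((a +i* b) - (c +i* d))). Qed.

Lemma hline_contract (y x x' : R) : cmod ((x' +i* y) - (x +i* y)) <= `|x' - x|.
Proof. by rewrite -[X in cmod X]/((x' - x) +i* (y - y)) subrr cmod_real. Qed.

Lemma vline_contract (x y y' : R) : cmod ((x +i* y') - (x +i* y)) <= `|y' - y|.
Proof. by rewrite -[X in cmod X]/((x - x) +i* (y' - y)) subrr cmod_im. Qed.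

Definition ccont_rect k (a b c d : R) := forall x y, a <= x <= b -> c <= y <= d ->
  ccont_at k (x +i* y).

Lemma ccont_rect_sub k a b c d a' b' c' d' : a <= a' -> b' <= b -> c <= c' -> d' <= d ->
  ccont_rect k a b c d -> ccont_rect k a' b' c' d'.
Proof.
move=> ? ? ? ? H x y /andP[? ?] /andP[? ?]; apply: H; lra.
Qed.

(** Imaginary parts on horizontal edges and real parts on vertical ones are the integrands of
    [contour]. *)
Definition hedge k a b y := cont_on (fun x => Im (k (x +i* y))) a b.
Definition vedge k c d x := cont_on (fun y => Re (k (x +i* y))) c d.

Lemma hedge_ccont k a b y : (forall x, a <= x <= b -> ccont_at k (x +i* y)) -> hedge k a b y.
Proof.
move=> H x xb.
  apply: (@ccont_real k (fun x => x +i* y) (@Im R));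
  [exact: Im_contract|exact: hline_contract|exact: H].
Qed.

Lemma vedge_ccont k c d x : (forall y, c <= y <= d -> ccont_at k (x +i* y)) -> vedge k c d x.
Proof.
move=> H y yb.
apply: (@ccont_real k (fun y => x +i* y) (@Re R));
  [exact: Re_contract|exact: vline_contract|exact: H].
Qed.

Lemma edge_cont k a b c d : ccont_rect k a b c d ->
  (forall y, c <= y <= d -> hedge k a b y) /\ (forall x, a <= x <= b -> vedge k c d x).
Proof.
move=> H; split => [y yb|x xb]; [apply: hedge_ccont => x xb|apply: vedge_ccont => y yb]; exact: H.
Qed.

(* The imaginary part of the integral of k along the boundary of the rectangle
   [a, b] + i[c, d], counterclockwise: dz is dx on horizontal edges and i dy on
   vertical ones. The real part is never needed, since k can be rotated. *)
Definition contour k (a b c d : R) : R :=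
  segint (fun x => Im (k (x +i* c))) a b + segint (fun y => Re (k (b +i* y))) c d
  - segint (fun x => Im (k (x +i* d))) a b - segint (fun y => Re (k (a +i* y))) c d.

Lemma contour_hsplit k a m b c d : a <= m -> m <= b -> hedge k a b c -> hedge k a b d ->
  contour k a b c d = contour k a m c d + contour k m b c d.
Proof.
move=> am mb Hc Hd; rewrite /contour.
rewrite (segint_cat am mb Hc) (segint_cat am mb Hd); ring.
Qed.

Lemma contour_vsplit k a b c n d : c <= n -> n <= d -> vedge k c d a -> vedge k c d b ->
  contour k a b c d = contour k a b c n + contour k a b n d.
Proof.
move=> cn nd Va Vb; rewrite /contour.
rewrite (segint_cat cn nd Va) (segint_cat cn nd Vb); ring.
Qed.

Lemma segint_abs_le (f : R -> R) (M a b : R) : a <= b -> cont_on f a b ->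
  (forall x, a <= x <= b -> `|f x| <= M) -> `|segint f a b| <= M * (b - a).
Proof.
move=> ab F h; rewrite ler_norml -mulNr segint_ge_cst ?segint_le_cst// => x /h;
  by rewrite ler_norml => /andP[].
Qed.

Lemma contour_bound k a b c d (M : R) : a <= b -> c <= d ->
  hedge k a b c -> hedge k a b d -> vedge k c d a -> vedge k c d b ->
  (forall x y, a <= x <= b -> c <= y <= d -> (x = a \/ x = b) \/ (y = c \/ y = d) ->
    cmod (k (x +i* y)) <= M) ->
  `|contour k a b c d| <= M * (2 * ((b - a) + (d - c))).
Proof.
move=> ab cd Hc Hd Va Vb kM; rewrite /contour.
have aa : a <= a <= b by rewrite lexx. have bb : a <= b <= b by rewrite lexx andbT.
have cc : c <= c <= d by rewrite lexx. have dd : c <= d <= d by rewrite lexx andbT.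
have : `|segint (fun x => Im (k (x +i* c))) a b| <= M * (b - a).
  by apply: segint_abs_le => // x xb; apply: le_trans (Im_le_cmod _) (kM _ _ _ _ _); tauto.
have : `|segint (fun x => Im (k (x +i* d))) a b| <= M * (b - a).
  by apply: segint_abs_le => // x xb; apply: le_trans (Im_le_cmod _) (kM _ _ _ _ _); tauto.
have : `|segint (fun y => Re (k (a +i* y))) c d| <= M * (d - c).
  by apply: segint_abs_le => // x xb; apply: le_trans (Re_le_cmod _) (kM _ _ _ _ _); tauto.
have : `|segint (fun y => Re (k (b +i* y))) c d| <= M * (d - c).
  by apply: segint_abs_le => // x xb; apply: le_trans (Re_le_cmod _) (kM _ _ _ _ _); tauto.
rewrite !ler_norml => /andP[? ?] /andP[? ?] /andP[? ?] /andP[? ?]; apply/andP; split; lra.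
Qed.

Lemma contour_add k g a b c d : a <= b -> c <= d ->
  ccont_rect k a b c d -> ccont_rect g a b c d ->
  contour (fun z => k z + g z) a b c d = contour k a b c d + contour g a b c d.
Proof.
move=> ab cd /edge_cont [H V] /edge_cont [H' V']; rewrite /contour.
have aa : a <= a <= b by rewrite lexx. have bb : a <= b <= b by rewrite lexx andbT.
have cc : c <= c <= d by rewrite lexx. have dd : c <= d <= d by rewrite lexx andbT.
have Ea (z w : R[i]) : Im (z + w) = Im z + Im w by case: z w => ? ? [].
have Er (z w : R[i]) : Re (z + w) = Re z + Re w by case: z w => ? ? [].
have h y : c <= y <= d -> segint (fun x => Im (k (x +i* y) + g (x +i* y))) a b =
    segint (fun x => Im (k (x +i* y))) a b + segint (fun x => Im (g (x +i* y))) a b.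
  by move=> yb; rewrite -segint_add; [apply: segint_ext|exact: H|exact: H'].
have v x : a <= x <= b -> segint (fun y => Re (k (x +i* y) + g (x +i* y))) c d =
    segint (fun y => Re (k (x +i* y))) c d + segint (fun y => Re (g (x +i* y))) c d.
  by move=> yb; rewrite -segint_add; [apply: segint_ext|exact: V|exact: V'].
rewrite !h// !v//; ring.
Qed.

(** Cauchy's theorem for affine functions, by explicit integration; [goursat] subtracts them. *)
Lemma contour_affine (u w : R[i]) a b c d : a <= b -> c <= d ->
  contour (fun z => u + w * z) a b c d = 0.
Proof.
move=> ab cd; case: u w => [u1 u2] [w1 w2]; rewrite /contour /=.
have E (p q s t : R) : s <= t ->
    segint (fun x => p + q * x) s t = p * (t - s) + q * ((t ^+ 2 - s ^+ 2) / 2).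
  move=> st; rewrite segint_add; [|exact: cont_on_cst|exact/cont_on_scale/cont_on_id].
  by rewrite segint_cst// segint_scale ?segint_id//; exact: cont_on_id.
have hh y : segint (fun x => u2 + (w1 * y + w2 * x)) a b =
    (u2 + w1 * y) * (b - a) + w2 * ((b ^+ 2 - a ^+ 2) / 2).
  by rewrite -E//; apply: segint_ext => x _; ring.
have vv x : segint (fun y => u1 + (w1 * x - w2 * y)) c d =
    (u1 + w1 * x) * (d - c) + (- w2) * ((d ^+ 2 - c ^+ 2) / 2).
  by rewrite -E//; apply: segint_ext => y _; ring.
by rewrite !hh !vv; field.
Qed.
End Holomorphic.

Section Goursat.
Context {R : realType}.
Implicit Types (k g : R[i] -> R[i]) (z : R[i]).

Lemma ccont_affine (u w z : R[i]) : ccont_at (fun z => u + w * z) z.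
Proof.
move=> e e0; exists (e / (cmod w + 1)).
  by rewrite divr_gt0// ltr_wpDl// cmod_ge0.
move=> h; rewrite ltr_pdivlMr ?ltr_wpDl ?cmod_ge0// => hw.
have -> : u + w * (z + h) - (u + w * z) = w * h by ring.
rewrite cmod_mul; apply: le_lt_trans hw; rewrite mulrDr mulr1 mulrC lerDl; exact: cmod_ge0.
Qed.

Lemma ccont_add k g z : ccont_at k z -> ccont_at g z -> ccont_at (fun z => k z + g z) z.
Proof.
move=> K G e e0; have e2 : 0 < e / 2 by rewrite divr_gt0.
have [r r0 Hr] := K _ e2; have [s s0 Hs] := G _ e2.
exists (Num.min r s); first by rewrite lt_min r0 s0.
move=> h; rewrite lt_min => /andP[/Hr h1 /Hs h2].
have -> : k (z + h) + g (z + h) - (k z + g z) = (k (z + h) - k z) + (g (z + h) - g z) by ring.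
by apply: le_lt_trans (cmod_add _ _) _; rewrite [e]splitr ltrD.
Qed.

(** Bisection is run on the estimate |contour| <= e * (half perimeter)^2: the contour is additive,
    and each quarter receives a quarter of the bound. On a small rectangle the first-order expansion
    is removed, as its contour vanishes, and the remainder is at most of order e times the size, on
    a boundary of comparable length. *)
Lemma goursat k (a b c d : R) : a <= b -> c <= d ->
  ccont_rect k a b c d ->
  (forall x y, a <= x <= b -> c <= y <= d -> cdiff_at k (x +i* y)) ->
  contour k a b c d = 0.
Proof.
move=> ab cd kc kd.
suff S (e : R) : 0 < e -> `|contour k a b c d| <= e * ((b - a) + (d - c)) ^+ 2.
  apply/eqP; rewrite -normr_le0; apply/ler_addgt0Pr => e e0; rewrite add0r.
  set W := ((b - a) + (d - c)) ^+ 2 in S.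
  have W0 : 0 <= W by exact: sqr_ge0.
  have W1 : 0 < W + 1 by rewrite ltr_wpDl.
  apply: le_trans (S (e / (W + 1)) _) _; first by rewrite divr_gt0.
  by rewrite mulrAC ler_pdivrMr// ler_wpM2l ?(ltW e0)// lerDl.
move=> e0; pose P a b c d := `|contour k a b c d| <= e * ((b - a) + (d - c)) ^+ 2.
apply: (@rect_bisect _ P) => //.
  move=> a1 b1 c1 d1 ab1 cd1 aa1 bb1 cc1 dd1 m n; rewrite /P.
  have ma : a1 <= m by rewrite /m; lra.
  have mb : m <= b1 by rewrite /m; lra.
  have nc : c1 <= n by rewrite /n; lra.
  have nd : n <= d1 by rewrite /n; lra.
  have K1 := ccont_rect_sub aa1 bb1 cc1 dd1 kc.
  have K2 : ccont_rect k a1 m c1 d1 by apply: ccont_rect_sub K1.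
  have K3 : ccont_rect k m b1 c1 d1 by apply: ccont_rect_sub K1.
  have [H1 _] := edge_cont K1; have [_ V2] := edge_cont K2; have [_ V3] := edge_cont K3.
  have hc : hedge k a1 b1 c1 by apply: H1; rewrite lexx cd1.
  have hd : hedge k a1 b1 d1 by apply: H1; rewrite lexx cd1.
  have va : vedge k c1 d1 a1 by apply: V2; rewrite lexx ma.
  have vm : vedge k c1 d1 m by apply: V2; rewrite lexx ma.
  have vb : vedge k c1 d1 b1 by apply: V3; rewrite lexx mb.
  rewrite (contour_hsplit ma mb hc hd) (contour_vsplit nc nd va vm) (contour_vsplit nc nd vm vb).
  set W := (b1 - a1 + (d1 - c1)) ^+ 2.
  have -> : (m - a1 + (n - c1)) ^+ 2 = W / 4 by rewrite /m /n /W; field.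
  have -> : (b1 - m + (n - c1)) ^+ 2 = W / 4 by rewrite /m /n /W; field.
  have -> : (m - a1 + (d1 - n)) ^+ 2 = W / 4 by rewrite /m /n /W; field.
  have -> : (b1 - m + (d1 - n)) ^+ 2 = W / 4 by rewrite /m /n /W; field.
  move: (contour _ _ _ _ _) (contour _ _ _ _ _) (contour _ _ _ _ _) (contour _ _ _ _ _)
    => u1 u2 u3 u4.
  rewrite mulrA; set V := e * W.
  rewrite !ler_norml => /andP[? ?] /andP[? ?] /andP[? ?] /andP[? ?]; apply/andP; split; lra.
move=> p q pab qcd; have [D HD] := kd p q pab qcd.
(* Half of e, because the perimeter is twice the half perimeter w: (e / 2 * w) * (2 * w) = e *
   w^2. *)
have [r r0 Hr] := HD (e / 2) (divr_gt0 e0 (ltr0n _ 2)).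
exists (r / 2); first by rewrite divr_gt0.
move=> a1 b1 c1 d1 /andP[p1 p2] /andP[q1 q2] aa1 bb1 cc1 dd1 rab rcd; rewrite /P.
have ab1 : a1 <= b1 by lra. have cd1 : c1 <= d1 by lra.
have K1 := ccont_rect_sub aa1 bb1 cc1 dd1 kc.
set z0 := p +i* q in HD Hr.
(* Adding u - D z turns k z into k z - k z0 - D (z - z0), the remainder at z0. *)
pose u := D * z0 - k z0.
have E : contour k a1 b1 c1 d1 = contour (fun z => k z + (u + (- D) * z)) a1 b1 c1 d1.
  by rewrite contour_add// ?contour_affine ?addr0// => x y _ _; exact: ccont_affine.
rewrite E; set w := (b1 - a1 + (d1 - c1)).
have -> : e * w ^+ 2 = (e / 2 * w) * (2 * w) by field.
have K2 : ccont_rect (fun z => k z + (u + - D * z)) a1 b1 c1 d1.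
  by move=> x y xb yb; apply: ccont_add; [exact: K1|exact: ccont_affine].
have [H2 V2] := edge_cont K2.
have hc : hedge (fun z => k z + (u + - D * z)) a1 b1 c1 by apply: H2; rewrite lexx cd1.
have hd : hedge (fun z => k z + (u + - D * z)) a1 b1 d1 by apply: H2; rewrite lexx cd1.
have va : vedge (fun z => k z + (u + - D * z)) c1 d1 a1 by apply: V2; rewrite lexx ab1.
have vb : vedge (fun z => k z + (u + - D * z)) c1 d1 b1 by apply: V2; rewrite lexx ab1.
apply: (contour_bound ab1 cd1 hc hd va vb).
move=> x y /andP[x1 x2] /andP[y1 y2] _.
pose h := (x - p) +i* (y - q).
have hE : x +i* y = z0 + h by rewrite /z0 /h -[RHS]/((p + (x - p)) +i* (q + (y - q))) !subrKC.
have hw : cmod h <= w.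
  apply: le_trans (cmod_le_ReIm _) _; rewrite /h /= /w.
  by apply: lerD; rewrite ler_norml; apply/andP; split; lra.
have -> : k (x +i* y) + (u + - D * (x +i* y)) = k (z0 + h) - k z0 - D * h.
  by rewrite hE /u; ring.
apply: le_trans (Hr _ _) _; first by apply: le_lt_trans hw _; rewrite /w; lra.
by rewrite ler_wpM2l// ltW// divr_gt0.
Qed.
End Goursat.

(** * The centre of a square *)

Section CenterEstimate.
Context {R : realType}.
Implicit Types (k g f : R[i] -> R[i]) (z : R[i]).

Lemma cmod_sqr z : cmod z ^+ 2 = Re z ^+ 2 + Im z ^+ 2.
Proof. by case: z => a b; rewrite /cmod /= sqr_sqrtr// addr_ge0 ?sqr_ge0. Qed.

Lemma cmod_inv z : cmod z^-1 = (cmod z)^-1.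
Proof. exact: ComplexField.Normc.normcV. Qed.

Lemma cmod_div z w : cmod (z / w) = cmod z / cmod w.
Proof. by rewrite cmod_mul cmod_inv. Qed.

Lemma Re_divi z : Re ('i^-1 * z) = Im z.
Proof.
case: z => a b; have -> : 'i^-1 = - 'i :> R[i].
  rewrite -[LHS]mul1r; apply: (canLR (mulfK _)).
    by rewrite eq_complex /= oner_eq0 andbF.
  by rewrite mulNr -expr2 sqr_i opprK.
by rewrite /= oppr0 mul0r mulN1r opprK add0r.
Qed.

(* The sides of a square centred at 0 all reduce to the bottom one by a quarter turn. *)
Lemma kernel_Im_ge (s t gm eta : R) (w : R[i]) : 0 < s -> `|t| <= s -> 0 <= gm ->
  cmod (w - gm%:C) <= eta -> (gm / 2 - eta) / s <= Im (w / (t +i* (- s))).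
Proof.
move=> s0 ts g0 hw.
have -> : w / (t +i* (- s)) = (w - gm%:C) / (t +i* (- s)) + gm%:C / (t +i* (- s)).
  by rewrite -mulrDl subrK.
have -> (z z' : R[i]) : Im (z + z') = Im z + Im z' by case: z z' => ? ? [].
have E : Im (gm%:C / (t +i* (- s))) = gm * s / (t ^+ 2 + s ^+ 2).
  by rewrite /= sqrrN mul0r addr0; ring.
have t2 : t ^+ 2 <= s ^+ 2 by rewrite -(real_normK (num_real t)) lerXn2r// nnegrE ltW.
have d0 : 0 < t ^+ 2 + s ^+ 2 by rewrite ltr_wpDl ?sqr_ge0// exprn_gt0.
(* For |t| <= s, Im (1 / (t - i s)) = s / (t^2 + s^2) >= 1 / (2 s). *)
have h1 : gm / 2 / s <= gm * s / (t ^+ 2 + s ^+ 2).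
  rewrite ler_pdivlMr// mulrAC ler_pdivrMr// mulrAC ler_pdivrMr//.
  rewrite -!mulrA ler_wpM2l//; lra.
have h2 : cmod ((w - gm%:C) / (t +i* (- s))) <= eta / s.
  have m0 : s <= cmod (t +i* (- s)).
    by apply: le_trans (Im_le_cmod _); rewrite /= normrN gtr0_norm.
  rewrite cmod_div ler_pdivrMr; last exact: lt_le_trans m0.
  apply: (le_trans hw); rewrite mulrAC ler_pdivlMr// ler_wpM2l//.
  by apply: le_trans hw; exact: cmod_ge0.
have := le_trans (Im_le_cmod _) h2; rewrite ler_norml E mulrBl => /andP[h3 _]; lra.
Qed.

(** For constant g = gm the exact value is 2 pi gm. The cruder factor 4 comes from pointwise bounds
    alone: each of the four sides, of length 2 s, contributes at least gm - 2 eta by [kernel_Im_ge]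
    after a rotation. *)
Lemma contour_kernel_ge g (s gm eta : R) : 0 < s -> 0 <= gm ->
  (forall p q, `|p| <= s -> `|q| <= s -> cmod (g (p +i* q) - gm%:C) <= eta) ->
  let k := (fun z => g z / z) in
  hedge k (- s) s (- s) -> hedge k (- s) s s -> vedge k (- s) s (- s) -> vedge k (- s) s s ->
  4 * gm - 8 * eta <= contour k (- s) s (- s) s.
Proof.
move=> s0 g0 hg k Hb Ht Vl Vr; rewrite /contour.
have ss : - s <= s by lra.
have sb : `|s| <= s by rewrite gtr0_norm. have sb' : `|- s| <= s by rewrite normrN.
pose m := (gm / 2 - eta) / s.
have mE : m * (s - - s) = gm - 2 * eta by rewrite /m; field; rewrite gt_eqF.
have rot (w z j : R[i]) : j != 0 -> w / (j * z) = j^-1 * (w / z).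
  by move=> j0; rewrite invfM mulrCA.
have B : m * (s - - s) <= segint (fun x => Im (k (x +i* (- s)))) (- s) s.
  apply: segint_ge_cst => // x; rewrite -ler_norml => xs.
  by apply: kernel_Im_ge => //; exact: hg.
(* The top and left sides are traversed backwards, hence upper bounds for their integrals. *)
have T : segint (fun x => Im (k (x +i* s))) (- s) s <= - m * (s - - s).
  apply: segint_le_cst => // x; rewrite -ler_norml => xs.
  rewrite lerNr -[X in X <= _]/m.
  apply: le_trans (@kernel_Im_ge s (- x) gm eta (g (x +i* s)) s0 _ g0 (hg _ _ xs sb)) _.
    by rewrite normrN.
  have -> : (- x) +i* (- s) = - (x +i* s) by [].
  by rewrite /k invrN mulrN; case: (_ / _).
have Rr : m * (s - - s) <= segint (fun y => Re (k (s +i* y))) (- s) s.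
  apply: segint_ge_cst => // y; rewrite -ler_norml => ys.
  apply: le_trans (@kernel_Im_ge s y gm eta (g (s +i* y)) s0 ys g0 (hg _ _ sb ys)) _.
  rewrite /k; have -> : s +i* y = 'i * (y +i* (- s)).
    by rewrite -[RHS]/((0 * y - 1 * - s) +i* (0 * - s + 1 * y)) !mul0r !mul1r opprK !add0r.
  have i0 : 'i != 0 :> R[i] by rewrite eq_complex /= oner_eq0 andbF.
  by rewrite rot// Re_divi.
have L : segint (fun y => Re (k ((- s) +i* y))) (- s) s <= - m * (s - - s).
  apply: segint_le_cst => // y; rewrite -ler_norml => ys.
  rewrite lerNr -[X in X <= _]/m.
  have ys' : `|- y| <= s by rewrite normrN.
  apply: le_trans (@kernel_Im_ge s (- y) gm eta (g ((- s) +i* y)) s0 ys' g0 (hg _ _ sb' ys)) _.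
  rewrite /k; have E : (- s) +i* y = - 'i * ((- y) +i* (- s)).
    by rewrite -[RHS]/((- 0 * - y - - 1 * - s) +i* (- 0 * - s + - 1 * - y))
      !oppr0 !mul0r !mulN1r !opprK !add0r.
  set G := g _; rewrite E.
  have i0 : - 'i != 0 :> R[i] by rewrite oppr_eq0 eq_complex /= oner_eq0 andbF.
  have Rn z : Re (- z) = - Re z by case: z.
  by rewrite rot// invrN mulNr Rn opprK Re_divi.
lra.
Qed.
End CenterEstimate.

Section Rotation.
Context {R : realType}.
Implicit Types (k g f : R[i] -> R[i]) (z : R[i]).

(** The contour of g(z) / z is the same on the large square and on a small one about 0. On the
    former it is at most the perimeter 8 a times B / a, on the latter at least 4 gm - 4 e; hence gm
    <= 2 B + e. *)
Lemma center_bound_real g (a B gm : R) : 0 < a -> 0 <= gm -> g 0 = gm%:C ->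
  (forall p q, `|p| <= a -> `|q| <= a -> differentiable g (p +i* q)) ->
  (forall p q, `|p| <= a -> `|q| <= a -> `|p| = a \/ `|q| = a -> cmod (g (p +i* q)) <= B) ->
  gm <= 2 * B.
Proof.
move=> a0 gm0 g0 dg gB.
apply/ler_addgt0Pr => e e0.
have z0 : `|0 : R| <= a by rewrite normr0 ltW.
have [r r0 Hr] := differentiable_ccont (dg 0 0 z0 z0) (divr_gt0 e0 (ltr0n R 2)).
(* Points of the small square have modulus at most 2 s < r, so g is within e / 2 of g 0 there. *)
pose s := Num.min (a / 2) (r / 4).
have s0 : 0 < s by rewrite lt_min !divr_gt0.
have sa : s <= a / 2 by rewrite ge_min lexx.
have sr : s <= r / 4 by rewrite ge_min lexx orbT.
clearbody s.
pose k := (fun z => g z / z).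
have dk p q : `|p| <= a -> `|q| <= a -> (p != 0) || (q != 0) -> differentiable k (p +i* q).
  by move=> pa qa pq; apply: differentiable_divid; [rewrite eq_complex negb_and|exact: dg].
have kc p q : `|p| <= a -> `|q| <= a -> (p != 0) || (q != 0) -> ccont_at k (p +i* q).
  by move=> pa qa pq; exact/differentiable_ccont/dk.
have goursat0 x0 x1 y0 y1 : x0 <= x1 -> y0 <= y1 -> - a <= x0 -> x1 <= a -> - a <= y0 -> y1 <= a ->
   (x1 < 0 \/ 0 < x0) \/ (y1 < 0 \/ 0 < y0) -> contour k x0 x1 y0 y1 = 0.
  move=> x01 y01 ax0 ax1 ay0 ay1 off.
  have H x y : x0 <= x <= x1 -> y0 <= y <= y1 -> differentiable k (x +i* y).
    move=> /andP[h1 h2] /andP[h3 h4]; apply: dk; try by (rewrite ler_norml; apply/andP; split; lra).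
    case: off => -[] h; apply/orP; [left|left|right|right].
    - by rewrite lt_eqF//; exact: le_lt_trans h.
    - by rewrite gt_eqF//; exact: lt_le_trans h1.
    - by rewrite lt_eqF//; exact: le_lt_trans h.
    - by rewrite gt_eqF//; exact: lt_le_trans h3.
  by apply: goursat => // x y xb yb; [exact/differentiable_ccont/H|exact/differentiable_cdiff/H].
have HE x0 x1 y : - a <= x0 -> x1 <= a -> `|y| <= a -> y != 0 -> hedge k x0 x1 y.
  move=> h1 h2 ya y0; apply: hedge_ccont => x /andP[h3 h4].
  apply: kc => //; last by rewrite y0 orbT.
  by rewrite ler_norml; apply/andP; split; lra.
have VE x0 x1 y : - a <= x0 -> x1 <= a -> `|y| <= a -> y != 0 -> vedge k x0 x1 y.
  move=> h1 h2 ya y0; apply: vedge_ccont => x /andP[h3 h4].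
  apply: kc => //; last by rewrite y0.
  by rewrite ler_norml; apply/andP; split; lra.
have s_le : - a <= - s by lra. have s_le' : s <= a by lra.
have as' : - a <= s by lra. have sa' : - s <= a by lra.
have aa : - a <= a by lra. have ss : - s <= s by lra.
have aN : `|- a| <= a by rewrite normrN gtr0_norm. have aP : `|a| <= a by rewrite gtr0_norm.
have sN : `|- s| <= a by rewrite normrN gtr0_norm. have sP : `|s| <= a by rewrite gtr0_norm.
have a1 : - a != 0 by rewrite lt_eqF; lra. have a2 : a != 0 by rewrite gt_eqF.
have s1 : - s != 0 by rewrite lt_eqF; lra. have s2 : s != 0 by rewrite gt_eqF.
have hb : hedge k (- a) a (- a) by exact: HE.
have ht : hedge k (- a) a a by exact: HE.
(* Around the small square, the large one is cut into left and right strips of full height and two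
   blocks below and above; none of the four contains 0. *)
have E : contour k (- a) a (- a) a = contour k (- s) s (- s) s.
  rewrite (contour_hsplit s_le sa' hb ht).
  rewrite (contour_hsplit ss s_le' (HE _ _ _ s_le (lexx a) aN a1) (HE _ _ _ s_le (lexx a) aP a2)).
  rewrite (contour_vsplit s_le sa' (VE _ _ _ (lexx _) (lexx _) sN s1)
    (VE _ _ _ (lexx _) (lexx _) sP s2)).
  rewrite (contour_vsplit ss s_le' (VE _ _ _ s_le (lexx _) sN s1) (VE _ _ _ s_le (lexx _) sP s2)).
  have -> : contour k (- a) (- s) (- a) a = 0.
    by apply: goursat0 => //; left; left; rewrite oppr_lt0.
  have -> : contour k s a (- a) a = 0 by apply: goursat0 => //; left; right.
  have -> : contour k (- s) s (- a) (- s) = 0.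
    by apply: goursat0 => //; right; left; rewrite oppr_lt0.
  have -> : contour k (- s) s s a = 0 by apply: goursat0 => //; right; right.
  by rewrite !addr0 !add0r.
have lo : 4 * gm - 8 * (e / 2) <= contour k (- s) s (- s) s.
  apply: contour_kernel_ge; [exact: s0|exact: gm0| |exact: HE|exact: HE|exact: VE|exact: VE].
  move=> p q ps qs; rewrite -g0 -[p +i* q]add0r; apply: ltW; apply: Hr.
  apply: le_lt_trans (cmod_le_ReIm _) _ => /=; lra.
have hi : `|contour k (- a) a (- a) a| <= B / a * (2 * ((a - - a) + (a - - a))).
  apply: contour_bound; [exact: aa|exact: aa|exact: hb|exact: ht|exact: VE|exact: VE|].
  move=> x y; rewrite -!ler_norml => xa ya xy.
  have bd : `|x| = a \/ `|y| = a.
    by case: xy => -[] ->; [left|left|right|right]; rewrite ?normrN gtr0_norm.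
  have am : a <= cmod (x +i* y).
    by case: bd => <-; [exact: (@Re_le_cmod _ (x +i* y))|exact: (@Im_le_cmod _ (x +i* y))].
  have m0 := lt_le_trans a0 am.
  rewrite /k cmod_div ler_pdivrMr// mulrAC ler_pdivlMr//.
  have gb := gB _ _ xa ya bd.
  by apply: ler_pM => //; [exact: cmod_ge0|exact: ltW].
have Ba : B / a * (2 * ((a - - a) + (a - - a))) = 8 * B by field.
rewrite Ba E in hi; have := le_trans (ler_norm _) hi; lra.
Qed.

(** Multiplying by the conjugate of g 0 makes the central value |g 0|^2; the extra factor |g 0| on
    the boundary then cancels. *)
Lemma center_bound g (a B : R) : 0 < a ->
  (forall p q, `|p| <= a -> `|q| <= a -> differentiable g (p +i* q)) ->
  (forall p q, `|p| <= a -> `|q| <= a -> `|p| = a \/ `|q| = a -> cmod (g (p +i* q)) <= B) ->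
  cmod (g 0) <= 2 * B.
Proof.
move=> a0 dg gB.
have B0 : 0 <= B.
  apply: le_trans (cmod_ge0 _) (gB a a _ _ _); rewrite ?gtr0_norm//; by left.
have [->|n0] := eqVneq (cmod (g 0)) 0; first by rewrite mulr_ge0.
have n0' : 0 < cmod (g 0) by rewrite lt_neqAle eq_sym n0 cmod_ge0.
have J : cmod (conjc (g 0)) = cmod (g 0) by case: (g 0) => x y; rewrite /cmod /= sqrrN.
have := @center_bound_real (fun z => conjc (g 0) * g z) a
  (cmod (g 0) * B) (cmod (g 0) ^+ 2) a0 (sqr_ge0 _).
rewrite mulrCA expr2 ler_pM2l//; apply.
- rewrite mulrC -expr2 cmod_sqr; case: (g 0) => x y /=.
  by apply/eqP; rewrite eq_complex /=; apply/andP; split; apply/eqP; ring.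
- by move=> p q pa qa; apply: differentiable_mulf; [exact: differentiable_cst|exact: dg].
- by move=> p q pa qa pq; rewrite cmod_mul J ler_wpM2l ?cmod_ge0//; exact: gB.
Qed.

(* Multiply f by its three rotations about the centre: on each side of the
   square one of the four factors is at most e. *)
Lemma small_side_center f (a e M : R) : 0 < a -> 0 <= e ->
  (forall p q, `|p| <= a -> `|q| <= a -> differentiable f (p +i* q)) ->
  (forall p q, `|p| <= a -> `|q| <= a -> cmod (f (p +i* q)) <= M) ->
  (forall p, `|p| <= a -> cmod (f (p +i* (- a))) <= e) ->
  cmod (f 0) ^+ 4 <= 2 * (e * M ^+ 3).
Proof.
move=> a0 e0 df fM fe.
have M0 : 0 <= M.
  by apply: le_trans (cmod_ge0 _) (fM a a _ _); rewrite ?gtr0_norm.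
pose g z := (f z * f ('i * z)) * (f (- 1 * z) * f (- 'i * z)).
have r1 p q : 'i * (p +i* q) = (- q) +i* p :> R[i].
  by rewrite -[LHS]/((0 * p - 1 * q) +i* (0 * q + 1 * p)) !mul0r !mul1r sub0r add0r.
have r2 p q : - 1 * (p +i* q) = (- p) +i* (- q) :> R[i] by rewrite mulN1r.
have r3 p q : - 'i * (p +i* q) = q +i* (- p) :> R[i].
  by rewrite mulNr r1 -[LHS]/((- - q) +i* (- p)) opprK.
have g0E : cmod (g 0) = cmod (f 0) ^+ 4.
  by rewrite /g !mulr0 !cmod_mul; ring.
rewrite -g0E; apply: (@center_bound g a _ a0).
  move=> p q pa qa; have pN : `|- p| <= a by rewrite normrN.
  have qN : `|- q| <= a by rewrite normrN.
  apply: differentiable_mulf; apply: differentiable_mulf;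
    [exact: df|..]; apply: differentiable_mull_arg; rewrite ?r1 ?r2 ?r3; exact: df.
move=> p q pa qa pq; have pN : `|- p| <= a by rewrite normrN.
have qN : `|- q| <= a by rewrite normrN.
rewrite /g r1 r2 r3 !cmod_mul.
have ME (x1 x2 x3 x4 : R) : 0 <= x1 -> 0 <= x2 -> 0 <= x3 -> 0 <= x4 ->
   x1 <= e -> x2 <= M -> x3 <= M -> x4 <= M -> x1 * x2 * (x3 * x4) <= e * M ^+ 3.
  move=> *; rewrite -mulrA ler_pM ?mulr_ge0// exprS expr2 ler_pM ?mulr_ge0//.
  by rewrite ler_pM.
have sgn (x : R) : `|x| = a -> x = a \/ x = - a.
  by move=> <-; have [h|h] := leP 0 x;
    [left; rewrite ger0_norm|right; rewrite ltr0_norm// opprK].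
have h1 := fM p q pa qa; have h2 := fM (- q) p qN pa.
have h3 := fM _ _ pN qN; have h4 := fM q (- p) qa pN.
(* On the right, left, top and bottom sides in turn, the factor evaluated on the bottom side is
   f(-iz), f(iz), f(-z), f(z). *)
case: pq => /sgn [] E.
- have h : cmod (f (q +i* (- p))) <= e by rewrite E; exact: fe.
  by rewrite mulrC [X in X * _]mulrC; apply: ME => //; exact: cmod_ge0.
- have h : cmod (f ((- q) +i* p)) <= e by rewrite E; exact: fe.
  by rewrite [X in X * _]mulrC; apply: ME => //; exact: cmod_ge0.
- have h : cmod (f ((- p) +i* (- q))) <= e by rewrite E; apply: fe; rewrite normrN.
  by rewrite mulrC; apply: ME => //; exact: cmod_ge0.
- have h : cmod (f (p +i* q)) <= e by rewrite E; exact: fe.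
  by apply: ME => //; exact: cmod_ge0.
Qed.
End Rotation.

(** * Pairs of holomorphic maps into a manifold *)

Section MetricModulus.
Context {R : realType}.

(** Makes an implication between vanishing conditions quantitative; used to compare the metric with
    the distance in a chart, in both directions. *)
Lemma compact_modulus (T : topologicalType) (A : set T) (D1 D2 : T -> R) : compact A ->
  (forall t, A t -> {for t, continuous D1}) -> (forall t, A t -> {for t, continuous D2}) ->
  (forall t, A t -> D1 t <= 0 -> D2 t <= 0) ->
  forall e, 0 < e -> exists2 h : R, 0 < h & forall t, A t -> D1 t < h -> D2 t < e.
Proof.
move=> cA c1 c2 H e e0.
have [[t0 At0]|nA] := pselect (A !=set0); last first.
  by exists 1 => // t At; case: nA; exists t.
(* phi > 0 on A, and its minimum is the required h. *)
pose phi t := Num.max (D1 t) (e - D2 t).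
have [] := @compact_EVT_min T R phi A _ cA.
- by exists t0.
- apply: continuous_in_subspaceT => t; rewrite inE => At.
  apply: (@continuous_max _ _ D1 (fun t => e - D2 t)); first exact: c1.
  by apply: cvgB; [exact: cvg_cst|exact: c2].
move=> c; rewrite inE => Ac Hc; exists (phi c).
  rewrite lt_max; have [//|h] := ltP 0 (D1 c); rewrite subr_gt0 /=.
  exact: le_lt_trans (H _ Ac h) e0.
move=> t At tc; have : phi c <= phi t by apply: Hc; rewrite inE.
rewrite {2}/phi le_max leNgt tc /= => hh.
have : 0 < e - D2 t.
  apply: lt_le_trans hh; rewrite lt_max; have [//|h] := ltP 0 (D1 c); rewrite subr_gt0 /=.
  exact: le_lt_trans (H _ Ac h) e0.
by rewrite subr_gt0.
Qed.

Lemma mdist_nbhsP (X : metricType R) (p : X) (U : set X) :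
  nbhs p U <-> exists2 r : R, 0 < r & forall q, mdist p q < r -> U q.
Proof.
split=> [/nbhs_ballP[r r0 H]|[r r0 H]].
  by exists r => // q pq; apply: H; rewrite ballEmdist.
by apply/nbhs_ballP; exists r => // q; rewrite ballEmdist; exact: H.
Qed.

Lemma mdist_dist2 (X : metricType R) (a b c d : X) :
  `|mdist a b - mdist c d| <= mdist a c + mdist b d.
Proof.
have h1 := metric_triangle a c b; have h2 := metric_triangle c d b.
have h3 := metric_triangle c a d; have h4 := metric_triangle a b d.
have h5 := metric_sym b d; have h6 := metric_sym a c.
by rewrite ler_norml; apply/andP; split; lra.
Qed.

Lemma mdist_continuous (X : metricType R) (t : X * X) :
  {for t, continuous (fun t : X * X => mdist t.1 t.2)}.
Proof.
case: t => p q; apply/cvgrPdist_lt => e e0 /=.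
have e2 : 0 < e / 2 by rewrite divr_gt0.
exists ([set x | mdist p x < e / 2], [set x | mdist q x < e / 2]).
  by split; apply/mdist_nbhsP; exists (e / 2).
move=> [x y] [/= px qy]; apply: le_lt_trans (mdist_dist2 _ _ _ _) _.
by rewrite [e]splitr ltrD.
Qed.

Lemma cmod_continuous : continuous (@cmod R : R[i] -> R).
Proof.
move=> z; apply: (proj2 (@cvgrPdist_lt _ _ _ (nbhs z) (nbhs_filter z) _ _)) => e e0.
apply/nbhs_ballP; exists (e%:C); first by rewrite /= ltcR.
move=> w h0; have h : cmod (z - w) < e by rewrite -ltcR -cmodE; exact: h0.
apply: le_lt_trans h.
have h1 := cmod_add (z - w) w; have h2 := cmod_add (w - z) z.
rewrite !subrK in h1 h2; rewrite cmod_distC in h2.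
rewrite ler_norml [cmod (z - w)]cmod_distC.
by rewrite [cmod (z - w)]cmod_distC in h1 h2;
  apply/andP; split; lra.
Qed.
End MetricModulus.

Lemma coord_diff_continuous (K : numFieldType) (n : nat) (X : topologicalType)
  (phi : X -> 'rV[K]_n) (t : X * X) (j : 'I_n) :
  {for t.1, continuous phi} -> {for t.2, continuous phi} ->
  {for t, continuous (fun t : X * X => phi t.1 ord0 j - phi t.2 ord0 j)}.
Proof.
move=> c1 c2.
have C (x : X) : {for x, continuous phi} -> {for x, continuous (fun x => phi x ord0 j)}.
  move=> c; apply: (@continuous_comp _ _ _ phi (fun v : 'rV[K]_n => v ord0 j)) => //.
  exact: coord_continuous.
apply: cvgB.
  by apply: (@continuous_comp _ _ _ fst (fun x => phi x ord0 j)); [exact: cvg_fst|exact: C].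
by apply: (@continuous_comp _ _ _ snd (fun x => phi x ord0 j)); [exact: cvg_snd|exact: C].
Qed.

Section Chart.
Context {R : realType} {n : nat} {X : metricType R}.
Implicit Type (c : chart R n X).

(** The l^1 distance: real-valued, and controlled one coordinate at a time, as the estimate at the
    centre concerns scalar functions. *)
Definition cdist (v w : 'rV[R[i]]_n) : R := \sum_(j < n) cmod (v ord0 j - w ord0 j).

Lemma cdist_ge j (v w : 'rV[R[i]]_n) : cmod (v ord0 j - w ord0 j) <= cdist v w.
Proof. by rewrite /cdist (bigD1 j)//= lerDl sumr_ge0// => i _; exact: cmod_ge0. Qed.

Lemma cdist_eq0 (v w : 'rV[R[i]]_n) : cdist v w <= 0 -> v = w.
Proof.
move=> h; apply/rowP => j; apply/eqP; rewrite -subr_eq0; apply/eqP.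
apply: ComplexField.Normc.eq0_normc; apply/eqP.
rewrite -[_ == _]/(cmod _ == 0) eq_le cmod_ge0 andbT.
by apply: le_trans h; exact: cdist_ge.
Qed.

Lemma cdist_chart_continuous c (t : X * X) : chart_dom c t.1 -> chart_dom c t.2 ->
  {for t, continuous (fun t : X * X => cdist (chart_map c t.1) (chart_map c t.2))}.
Proof.
move=> d1 d2; have C x : chart_dom c x -> {for x, continuous (chart_map c)}.
  by move=> dx; have := @chart_map_continuous _ _ _ c; rewrite continuous_open_subspace;
    [apply; rewrite inE|exact: chart_dom_open].
rewrite /cdist; apply: cvg_big => [|j _]; first exact: add_continuous.
apply: (@continuous_comp _ _ _ (fun t : X * X => chart_map c t.1 ord0 j - chart_map c t.2 ord0 j)
  (@cmod R)).
  by apply: coord_diff_continuous; exact: C.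
exact: cmod_continuous.
Qed.

(** Each coordinate of the difference in the chart goes through [small_side_center]; compactness of
    N translates metric into chart distance on the bottom side and back at the centre. The scalar
    estimate does not involve the size of the square, so h depends neither on a nor on f and g. *)
Lemma chart_pair c (N : set X) : compact N -> N `<=` chart_dom c ->
  forall e, 0 < e -> exists2 h : R, 0 < h & forall (a : R) (f g : R[i] -> X), 0 < a ->
    (forall p q, `|p| <= a -> `|q| <= a -> N (f (p +i* q)) /\ N (g (p +i* q))) ->
    (forall p q j, `|p| <= a -> `|q| <= a ->
      differentiable (fun w => chart_map c (f w) ord0 j) (p +i* q)) ->
    (forall p q j, `|p| <= a -> `|q| <= a ->
      differentiable (fun w => chart_map c (g w) ord0 j) (p +i* q)) ->
    (forall p, `|p| <= a -> mdist (f (p +i* (- a))) (g (p +i* (- a))) < h) ->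
    mdist (f 0) (g 0) < e.
Proof.
move=> cN Nc e e0.
pose D (t : X * X) := cdist (chart_map c t.1) (chart_map c t.2).
have cA : compact (N `*` N) by exact: compact_setX.
have cD t : (N `*` N) t -> {for t, continuous D}.
  by case: t => x y [/= /Nc Nx /Nc Ny]; exact: cdist_chart_continuous.
have cd t : (N `*` N) t -> {for t, continuous (fun t : X * X => mdist t.1 t.2)}.
  by move=> _; exact: mdist_continuous.
have [h2 h20 H2] : exists2 h : R, 0 < h & forall t, (N `*` N) t -> D t < h -> mdist t.1 t.2 < e.
  apply: compact_modulus => // -[x y] [/= /Nc Nx /Nc Ny] /cdist_eq0 E.
  by rewrite -(chart_mapK Nx) E chart_mapK// mdistxx.
have [M M0 HM] : exists2 M : R, 0 < M & forall t, (N `*` N) t -> D t <= M.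
  have [[t0 Nt0]|nA] := pselect ((N `*` N) !=set0); last first.
    by exists 1 => // t Nt; case: nA; exists t.
  have [] := @compact_EVT_max _ R D (N `*` N) _ cA.
  - by exists t0.
  - by apply: continuous_in_subspaceT => t; rewrite inE; exact: cD.
  move=> t1 _ Ht; exists (`|D t1| + 1); first by rewrite ltr_wpDl.
  move=> t Nt; apply: (le_trans (Ht t _)); first by rewrite inE.
  by apply: (le_trans (ler_norm _)); rewrite lerDl.
(* Dividing by n + 1 keeps the sum over n coordinates strictly below h2, even for n = 0; [e1] then
   makes 2 e1 M^3 at most eta^4. *)
pose eta := h2 / n.+1%:R.
have eta0 : 0 < eta by rewrite divr_gt0.
pose e1 := eta ^+ 4 / (4 * M ^+ 3).
have e10 : 0 < e1 by rewrite divr_gt0 ?mulr_gt0 ?exprn_gt0.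
have [h h0 H1] : exists2 h : R, 0 < h & forall t, (N `*` N) t -> mdist t.1 t.2 < h -> D t < e1.
  apply: compact_modulus => // -[x y] [/= /Nc Nx /Nc Ny] E.
  have -> : x = y by apply: mdist_positivity; apply/eqP; rewrite eq_le E mdist_ge0.
  by rewrite /D /cdist /= big1// => j _; rewrite subrr; exact: ComplexField.Normc.normc0.
exists h => // a f g a0 Nfg df dg fg.
have z0 : `|0 : R| <= a by rewrite normr0 ltW.
have [Nf Ng] := Nfg 0 0 z0 z0.
apply: (H2 (f 0, g 0)) => //=; rewrite /D /=.
have small j : cmod (chart_map c (f 0) ord0 j - chart_map c (g 0) ord0 j) <= eta.
  have := @small_side_center R (fun w => chart_map c (f w) ord0 j - chart_map c (g w) ord0 j)
    a e1 M a0 (ltW e10).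
  move=> S; have {}S := S _ _ _.
  rewrite -(@ler_pXn2r _ 4) ?nnegrE ?cmod_ge0 ?(ltW eta0)//.
  apply: le_trans (S _ _ _) _.
  - by move=> p q pa qa; apply: differentiable_subf; [exact: df|exact: dg].
  - move=> p q pa qa; have [Nfp Ngp] := Nfg p q pa qa.
    by apply: (le_trans (cdist_ge _ _ _)); apply: (HM (f (p +i* q), g (p +i* q))).
  - move=> p pa; have aa : `|- a| <= a by rewrite normrN gtr0_norm.
    have [Nfp Ngp] := Nfg p _ pa aa; apply: ltW.
    by apply: (le_lt_trans (cdist_ge _ _ _)); apply: (H1 (f (p +i* (- a)), g (p +i* (- a)))) => //;
      exact: fg.
  have -> : 2 * (e1 * M ^+ 3) = eta ^+ 4 / 2 by rewrite /e1; field; rewrite gt_eqF.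
  by have := exprn_gt0 4 eta0; lra.
apply: (@le_lt_trans _ _ (\sum_(j < n) eta)); first by apply: ler_sum => j _; exact: small.
rewrite sumr_const card_ord -mulr_natr /eta mulrAC ltr_pdivrMr// ltr_pM2l// ltr_nat//.
Qed.
End Chart.

(** The near-covering form of compactness, with right neighbourhoods of 0, replaces the least radius
    of a finite subcover. [P] is not assumed monotone in the radius, hence the local condition for
    all s < r. *)
Lemma compact_near_right (R : realType) (T : topologicalType) (C : set T) (P : R -> T -> Prop) :
  compact C ->
  (forall x, C x -> exists2 r : R, 0 < r &
     \forall y \near x, forall s, 0 < s -> s < r -> P s y) ->
  exists2 r : R, 0 < r & forall y, C y -> P r y.
Proof.
move=> /compact_near_coveringP cC H.
have loc x : C x -> \forall x' \near x & s \near 0^'+, P s x'.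
  move=> Cx; have [r r0 Hr] := H x Cx.
  exists ([set y | forall s, 0 < s -> s < r -> P s y], [set s | 0 < s < r]).
    split => //.
    near=> s; apply/andP; split; near: s; [exact: nbhs_right_gt|exact: nbhs_right_lt].
  by move=> [y s] [/= h /andP[s0 sr]]; exact: h.
have gl := cC R (0^'+) P (at_right_proper_filter 0) loc.
have [r [Hr r0]] := @filter_ex _ _ (at_right_proper_filter 0) _ (filterI gl (nbhs_right_gt 0)).
by exists r.
Unshelve. all: by end_near. Qed.

Section UniformPair.
Context {R : realType} {n : nat} {X : metricType R}.
Variable (M : complex_atlas R n X).

(** Differentiability is asked in whichever chart contains the value, so that no chart has to be
    fixed in advance. *)
Definition hol_square (a : R) (f : R[i] -> X) := forall c p q j, atlas M c ->
  `|p| <= a -> `|q| <= a -> chart_dom c (f (p +i* q)) ->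
  differentiable (fun w => chart_map c (f w) ord0 j) (p +i* q).

(** A chart-free form of the conclusion of [chart_pair]: [rho] confines the images near x, [h]
    bounds the distance on the bottom side, [e] that at the centre. *)
Definition pair_close (C : set X) (rho e h : R) (x : X) := forall (a : R) (f g : R[i] -> X),
  0 < a -> hol_square a f -> hol_square a g ->
  (forall p q, `|p| <= a -> `|q| <= a ->
    [/\ C (f (p +i* q)), mdist x (f (p +i* q)) < rho,
        C (g (p +i* q)) & mdist x (g (p +i* q)) < rho]) ->
  (forall p, `|p| <= a -> mdist (f (p +i* (- a))) (g (p +i* (- a))) < h) ->
  mdist (f 0) (g 0) < e.

Lemma pair_close_mono C rho e h x rho' h' x' :
  mdist x x' + rho' <= rho -> h' <= h -> pair_close C rho e h x -> pair_close C rho' e h' x'.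
Proof.
move=> rr hh W a f g a0 hf hg H B; apply: (W a f g) => //.
- move=> p q pa qa; have [? f1 ? g1] := H p q pa qa; split => //.
  + by apply: (le_lt_trans (metric_triangle x x' _)); apply: lt_le_trans rr; rewrite ltrD2l.
  + by apply: (le_lt_trans (metric_triangle x x' _)); apply: lt_le_trans rr; rewrite ltrD2l.
- by move=> p pa; apply: lt_le_trans hh; exact: B.
Qed.

Lemma closed_mdist_ball (x : X) (s : R) : closed [set y | mdist x y <= s].
Proof.
apply: (@closed_comp _ _ (mdist x) [set r | r <= s]); last exact: closed_le.
move=> y _; apply/cvgrPdist_lt => e e0.
apply/mdist_nbhsP; exists e => // z yz.
by apply: (le_lt_trans (mdist_dist2 _ _ _ _)); rewrite mdistxx add0r.
Qed.

(** A ball of radius r about x lies in one chart, and the closed ball of half that radius meets C in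
    a compact set, to which [chart_pair] applies. *)
Lemma pair_close_local C x : compact C -> exists2 rho : R, 0 < rho &
  forall e, 0 < e -> exists2 h, 0 < h & pair_close C rho e h x.
Proof.
move=> cC; have [c cM cx] := atlas_cover M x.
have [r r0 Hr] : exists2 r : R, 0 < r & forall q, mdist x q < r -> chart_dom c q.
  by apply/mdist_nbhsP; apply: open_nbhs_nbhs; split => //; exact: chart_dom_open.
have r2 : 0 < r / 2 by rewrite divr_gt0.
exists (r / 2) => // e e0.
pose N := C `&` [set y | mdist x y <= r / 2].
have cN : compact N by apply: compact_closedI => //; exact: closed_mdist_ball.
have Nc : N `<=` chart_dom c by move=> y [_ /= xy]; apply: Hr; apply: (le_lt_trans xy); lra.
have [h h0 H] := chart_pair cN Nc e0; exists h => // a f g a0 hf hg Hfg B.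
have NN p q : `|p| <= a -> `|q| <= a -> N (f (p +i* q)) /\ N (g (p +i* q)).
  by move=> pa qa; have [? /ltW ? ? /ltW ?] := Hfg p q pa qa; split; split.
apply: (H a) => //.
- by move=> p q j pa qa; apply: hf => //; apply: Nc; case: (NN p q pa qa).
- by move=> p q j pa qa; apply: hg => //; apply: Nc; case: (NN p q pa qa).
Qed.

(** Compactness is used twice: for a radius common to all points and all e, then, given e, for a
    common h. Moving x costs half the radius each time. *)
Lemma pair_close_uniform C : compact C -> exists2 rho : R, 0 < rho &
  forall e, 0 < e -> exists2 h, 0 < h & forall x, C x -> pair_close C rho e h x.
Proof.
move=> cC.
have [rho rho0 Hrho] : exists2 rho : R, 0 < rho & forall x, C x ->
    forall e, 0 < e -> exists2 h, 0 < h & pair_close C rho e h x.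
  apply: (compact_near_right (P := fun rho x => forall e, 0 < e ->
    exists2 h, 0 < h & pair_close C rho e h x)) => // x Cx.
  have [r r0 Hr] := pair_close_local x cC.
  exists (r / 2); first by rewrite divr_gt0.
  apply/mdist_nbhsP; exists (r / 2); first by rewrite divr_gt0.
  move=> y xy s s0 sr e e0; have [h h0 W] := Hr e e0; exists h => //.
  by apply: pair_close_mono W => //; lra.
exists (rho / 2) => [|e e0]; first by rewrite divr_gt0.
apply: (compact_near_right (P := fun h x => pair_close C (rho / 2) e h x)) => // x Cx.
have [h h0 W] := Hrho x Cx e e0.
exists h => //; apply/mdist_nbhsP; exists (rho / 2); first by rewrite divr_gt0.
move=> y xy s s0 /ltW sh.
by apply: pair_close_mono W => //; lra.
Qed.
End UniformPair.

(** * Lines in the tube *)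

Lemma differentiable_along_line (K : numFieldType) (m n : nat) (G : 'rV[K]_m -> 'rV[K]_n)
    (zeta v : 'rV[K]_m) (w0 : K) (j : 'I_n) :
  differentiable G (zeta + w0 *: v) ->
  differentiable (fun w : K => G (zeta + w *: v) ord0 j) w0.
Proof.
move=> dG.
apply: (@differentiable_comp _ _ _ _ (fun w : K => G (zeta + w *: v))
  (fun M : 'rV[K]_n => M ord0 j)).
  apply: (@differentiable_comp _ _ _ _ (fun w : K => zeta + w *: v) G) => //.
exact: differentiable_coord.
Qed.

Section Lines.
Context {R : realType} {m : nat}.
Implicit Types (x y v t : 'rV[R]_m) (K : set 'rV[R]_m).

Definition pt x y : 'rV[R[i]]_m := map2_mx (@Complex R) x y.

Lemma tube_pt K x y : K y -> tube K (pt x y).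
Proof. by move=> Ky; exists x => //; exists y. Qed.

Lemma tubeP K z : tube K z -> exists x y, K y /\ z = pt x y.
Proof. by case=> x _ [y Ky <-]; exists x, y. Qed.

Lemma pt_shift x y t : pt x y + map_mx (real_complex R) t = pt (x + t) y.
Proof.
apply/rowP => j; rewrite !mxE.
by rewrite -[LHS]/((x ord0 j + t ord0 j) +i* (y ord0 j + 0)) addr0.
Qed.

Lemma pt_line x y v p q :
  pt x y + (p +i* q) *: map_mx (real_complex R) v = pt (x + p *: v) (y + q *: v).
Proof.
apply/rowP => j; rewrite !mxE.
rewrite -[LHS]/((x ord0 j + (p * v ord0 j - q * 0)) +i* (y ord0 j + (p * 0 + q * v ord0 j))).
by rewrite !mulr0 subr0 add0r.
Qed.

(** The sum gives the factor sqrt (2 m); 2 (m + 1) exceeds it and is always positive. *)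
Lemma euclidean_dist_pt x y x' y' (e : R) : 0 <= e ->
  (forall j, `|x ord0 j - x' ord0 j| <= e) -> (forall j, `|y ord0 j - y' ord0 j| <= e) ->
  euclidean_dist (pt x y) (pt x' y') <= 2 * m.+1%:R * e.
Proof.
move=> e0 hx hy; rewrite /euclidean_dist.
have c0 : 0 <= 2 * m.+1%:R * e by rewrite !mulr_ge0.
rewrite -(ger0_norm c0) -sqrtr_sqr ler_wsqrtr//.
apply: (@le_trans _ _ (\sum_(j < m) (2 * e ^+ 2))).
  apply: ler_sum => j _; rewrite !mxE /= mulr2n mulrDl !mul1r; apply: lerD.
    by rewrite -(real_normK (num_real (_ - _))) lerXn2r ?nnegrE.
  by rewrite -(real_normK (num_real (_ - _))) lerXn2r ?nnegrE.
rewrite sumr_const card_ord -mulr_natr.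
have m0 : (0 : R) <= m%:R by [].
rewrite -natr1 !exprMn; set M := m%:R in m0 *.
have : 0 <= e ^+ 2 by exact: sqr_ge0.
have : 0 <= M ^+ 2 by exact: sqr_ge0.
nra.
Qed.

Context {n : nat} {X : metricType R} (M : complex_atlas R n X) (Omega : set 'rV[R]_m)
  (F : 'rV[R[i]]_m -> X).

Lemma hol_square_line x y v (a : R) : holomorphic_map M (tube Omega) F ->
  (forall q, `|q| <= a -> Omega (y + q *: v)) ->
  hol_square M a (fun w => F (pt x y + w *: map_mx (real_complex R) v)).
Proof.
move=> [_ hF] Om c p q j cM pa qa dc.
apply: (@differentiable_along_line _ _ _ (fun z => chart_map c (F z))).
apply: (hF c cM); split => //.
by rewrite pt_line; apply: tube_pt; exact: Om.
Qed.

(* a0 is chosen before e, so that finitely many steps join any two heights. *)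
Lemma close_step K v : holomorphic_map M (tube Omega) F -> K `<=` Omega ->
  uniformly_continuous_on (tube K) F -> precompact (F @` tube K) ->
  exists2 a0 : R, 0 < a0 & forall a Yc, 0 < a -> a <= a0 ->
    (forall q, `|q| <= a -> K (Yc + q *: v)) ->
    forall e, 0 < e -> exists2 h : R, 0 < h & forall t t',
      (forall x, mdist (F (pt (x + t) (Yc - a *: v))) (F (pt (x + t') (Yc - a *: v))) < h) ->
      forall x, mdist (F (pt (x + t) Yc)) (F (pt (x + t') Yc)) < e.
Proof.
move=> hF KO uF; rewrite precompactE => cC.
set C := closure _ in cC.
have CF x y : K y -> C (F (pt x y)).
  by move=> Ky; apply: subset_closure; exists (pt x y) => //; exact: tube_pt.
have [rho rho0 Hrho] := pair_close_uniform M cC.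
(* Each map stays within rho / 3 of its value at the bottom midpoint, and these two values differ by
   less than rho / 3; both images thus lie within rho of the first value. *)
have [d d0 Hd] := uF (rho / 3) (divr_gt0 rho0 (ltr0n _ 3)).
have [V V0 HV] : exists2 V : R, 0 < V & forall j, `|v ord0 j| <= V.
  exists (1 + \sum_(j < m) `|v ord0 j|); first by rewrite ltr_pwDl// sumr_ge0.
  by move=> j; rewrite (bigD1 j)//= addrCA lerDl addr_ge0// sumr_ge0.
pose c : R := 2 * m.+1%:R.
have c0 : 0 < c by rewrite mulr_gt0.
(* From the bottom midpoint, coordinates change by at most 2 a V on the square, so distances are at
   most 2 a V c <= d / 2. *)
exists (d / (4 * c * V)); first by rewrite divr_gt0// !mulr_gt0.
move=> a Yc a_gt0 aa0 Ka e e0.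
have [h h0 W] := Hrho e e0.
exists (Num.min h (rho / 3)); first by rewrite lt_min h0 divr_gt0.
move=> t t' B x.
pose f s w := F (pt (x + s) Yc + w *: map_mx (real_complex R) v).
have fE s p q : f s (p +i* q) = F (pt (x + s + p *: v) (Yc + q *: v)) by rewrite /f pt_line.
have f0 s : f s 0 = F (pt (x + s) Yc) by rewrite /f scale0r addr0.
have osc s p q : `|p| <= a -> `|q| <= a -> mdist (f s (0 +i* (- a))) (f s (p +i* q)) < rho / 3.
  move=> pa qa; rewrite !fE; apply: Hd.
  - by apply: tube_pt; apply: Ka; rewrite normrN gtr0_norm.
  - by apply: tube_pt; exact: Ka.
  have e10 : 0 <= 2 * a * V by rewrite !mulr_ge0// ltW.
  apply: (le_lt_trans (@euclidean_dist_pt _ _ _ _ (2 * a * V) e10 _ _)).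
  - move=> j; rewrite !mxE mul0r addr0 opprD addNKr normrN normrM.
    by apply: ler_pM => //; apply: (le_trans pa); lra.
  - move=> j; rewrite !mxE opprD addrACA subrr add0r -mulrBl normrM.
    apply: ler_pM => //; apply: (le_trans (ler_normB _ _)).
    by rewrite normrN gtr0_norm//; lra.
  rewrite -/c; move: aa0; rewrite ler_pdivlMr ?mulr_gt0//.
  have := mulr_gt0 (mulr_gt0 c0 a_gt0) V0; nra.
rewrite -!f0; apply: (W (f t (0 +i* (- a))) _ a) => //.
- by rewrite fE; apply: CF; apply: Ka; rewrite normrN gtr0_norm.
- by apply: hol_square_line => // q qa; apply: KO; exact: Ka.
- by apply: hol_square_line => // q qa; apply: KO; exact: Ka.
- move=> p q pa qa; split.
  + by rewrite fE; apply: CF; exact: Ka.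
  + by apply: (lt_trans (osc t p q pa qa)); lra.
  + by rewrite fE; apply: CF; exact: Ka.
  + apply: (le_lt_trans (metric_triangle _ (f t' (0 +i* (- a))) _)).
    have := osc t' p q pa qa.
    have := B x; rewrite lt_min => /andP[_]; rewrite !fE !scale0r !addr0 scaleNr; lra.
- move=> p pa; have := B (x + p *: v); rewrite lt_min => /andP[+ _].
  by rewrite !fE scaleNr ![x + _ + p *: v]addrAC.
Qed.
End Lines.

(** * Propagation of closeness *)

(** Convexity gives the segment, openness the overshoot past y1, which makes room for the upper half
    of the last square, centred at y1. *)
Lemma segment_extend (R : realType) (m : nat) (Omega : set 'rV[R]_m) (y0 y1 : 'rV[R]_m) :
  convex_set Omega -> open Omega -> Omega y0 -> Omega y1 ->
  exists2 d : R, 0 < d & forall s, 0 <= s <= 1 + d -> Omega (y0 + s *: (y1 - y0)).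
Proof.
move=> cO oO O0 O1.
have C : {for (0 : R), continuous (fun s : R => y1 + s *: (y1 - y0))}.
  by apply: cvgD; [exact: cvg_cst|apply: cvgZr_tmp; exact: cvg_id].
have : nbhs (0 : R) [set s | Omega (y1 + s *: (y1 - y0))].
  by apply: C; rewrite scale0r addr0; apply: open_nbhs_nbhs; split.
move=> /nbhs_ballP[d /= d0 Hd]; exists (d / 2); first by rewrite divr_gt0.
move=> s /andP[s0 s1]; have [sle|sgt] := leP s 1.
  have := cO y1 y0 (Itv01 s0 sle); rewrite !inE => /(_ O1 O0).
  congr Omega; rewrite /conv /= /unstable.onem.
  by rewrite scalerBl scale1r scalerBr; exact: addrCA.
have -> : y0 + s *: (y1 - y0) = y1 + (s - 1) *: (y1 - y0).
  by apply/rowP => j; rewrite !mxE; ring.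
by apply: Hd; rewrite /ball /= sub0r normrN gtr0_norm; lra.
Qed.

Lemma segment_image_compact (R : realType) (m : nat) (y0 v : 'rV[R]_m) (l : R) :
  compact [set y0 + s *: v | s in `[0, l]].
Proof.
apply: (@continuous_compact _ _ (fun s : R => y0 + s *: v)); last exact: segment_compact.
apply: continuous_subspaceT => s.
by apply: cvgD; [exact: cvg_cst|apply: cvgZr_tmp; exact: cvg_id].
Qed.

(** The limit is a cluster point of u. Its bound uses the same e and N as the Cauchy condition, so
    an N common to a family of sequences gives uniform convergence. *)
Lemma compact_cauchy_limit (R : realType) (X : metricType R) (C : set X) (u : nat -> X) :
  compact C -> (forall k, C (u k)) ->
  exists p, forall e N, (forall k l, (N <= k)%N -> (N <= l)%N -> mdist (u k) (u l) < e) ->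
    forall k, (N <= k)%N -> mdist p (u k) <= e.
Proof.
move=> cC Cu.
have [] := cC (u @ \oo) _; first by exists 0%N => // k _; exact: Cu.
move=> p [_ clp]; exists p => e N H k Nk; apply/ler_addgt0Pl => d d0.
have [] := clp [set x | exists2 l, (N <= l)%N & x = u l] [set x | mdist p x < d].
- by exists N => // l Nl; exists l.
- by apply/mdist_nbhsP; exists d.
move=> x [[l Nl ->] /= pl].
apply: (le_trans (metric_triangle p (u l) (u k))); apply: lerD; apply: ltW => //.
exact: H.
Qed.

Section Propagation.
Context {R : realType} {m n : nat} {X : metricType R} (M : complex_atlas R n X).
Variables (Omega : set 'rV[R]_m) (F : 'rV[R[i]]_m -> X).
Hypotheses (cO : convex_set Omega) (oO : open Omega) (hF : holomorphic_map M (tube Omega) F)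
  (hK : forall K : set 'rV[R]_m, compact K -> K `<=` Omega ->
      uniformly_continuous_on (tube K) F /\ precompact (F @` tube K)).

(** N applications of [close_step] with a = 1 / N; as a does not depend on e, the required closeness
    can be pulled back step by step to y0. *)
Lemma close_line (y0 y1 : 'rV[R]_m) : Omega y0 -> Omega y1 ->
  forall e, 0 < e -> exists2 h : R, 0 < h & forall t t',
    (forall x, mdist (F (pt (x + t) y0)) (F (pt (x + t') y0)) < h) ->
    forall x, mdist (F (pt (x + t) y1)) (F (pt (x + t') y1)) < e.
Proof.
move=> O0 O1; have [d d0 Hd] := segment_extend cO oO O0 O1.
set v := y1 - y0 in Hd.
have cK := @segment_image_compact R m y0 v (1 + d).
have KO : [set y0 + s *: v | s in `[0, 1 + d]] `<=` Omega.
  by move=> _ [s /= sd <-]; apply: Hd; move: sd; rewrite in_itv.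
have [uF pF] := hK cK KO.
have [a0 a00 Ha] := @close_step _ _ _ _ _ _ _ _ v hF KO uF pF.
pose N := (Num.bound (Num.min a0 d)^-1).+1.
pose a : R := N%:R^-1.
have N0 : 0 < N%:R :> R by [].
have min0 : 0 < Num.min a0 d by rewrite lt_min a00 d0.
have amin : a <= Num.min a0 d.
  rewrite /a -[leRHS]invrK lef_pV2 ?posrE ?invr_gt0//.
  apply: (le_trans (ltW (archi_boundP _))); first by rewrite invr_ge0 ltW.
  by rewrite ler_nat.
have [aa0 ad] : a <= a0 /\ a <= d by move: amin; rewrite le_min => /andP[].
have a_gt0 : 0 < a by rewrite invr_gt0.
suff S k : (k <= N)%N -> forall e, 0 < e -> exists2 h : R, 0 < h & forall t t',
    (forall x, mdist (F (pt (x + t) y0)) (F (pt (x + t') y0)) < h) ->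
    forall x, mdist (F (pt (x + t) (y0 + (k%:R * a) *: v)))
      (F (pt (x + t') (y0 + (k%:R * a) *: v))) < e.
  by have := S N (leqnn N); rewrite /a divff ?gt_eqF// scale1r /v addrC subrK.
elim: k => [|k ih] kN e e0.
  by exists e => // t t' H x; rewrite mul0r scale0r addr0.
have kaN : k.+1%:R * a <= 1 by rewrite /a ler_pdivrMr// mul1r ler_nat.
have ka0 : a <= k.+1%:R * a by rewrite ler_peMl ?ler1n// ltW.
(* The square is centred at step k + 1 and has its bottom side at step k; it stays over the extended
   segment because a <= (k + 1) a <= 1 and a <= d. *)
have [q qa|h1 h10 H1] := Ha a (y0 + (k.+1%:R * a) *: v) a_gt0 aa0 _ e e0.
  exists (k.+1%:R * a + q); last by rewrite scalerDl addrA.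
  by move: qa; rewrite /= in_itv /= ler_norml => /andP[q1 q2]; apply/andP; split; lra.
have [h h0 H] := ih (ltnW kN) h1 h10; exists h => // t t' B.
apply: H1 => x; rewrite -addrA -scalerBl -natr1 mulrDl mul1r addrK; exact: H.
Qed.

(** [close_line] treats one height, uniform continuity carries the estimate to nearby heights at a
    cost of 2 e / 3, and compactness of K makes h uniform. *)
Lemma close_tube (y0 : 'rV[R]_m) (K : set 'rV[R]_m) : compact K -> K `<=` Omega -> Omega y0 ->
  forall e, 0 < e -> exists2 h : R, 0 < h & forall t t',
    (forall x, mdist (F (pt (x + t) y0)) (F (pt (x + t') y0)) < h) ->
    forall x y, K y -> mdist (F (pt (x + t) y)) (F (pt (x + t') y)) < e.
Proof.
move=> cK KO O0 e e0; have [uF _] := hK cK KO.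
have e3 : 0 < e / 3 by rewrite divr_gt0.
have [d d0 Hd] := uF _ e3.
pose P h (y : 'rV[R]_m) := K y -> forall t t',
    (forall x, mdist (F (pt (x + t) y0)) (F (pt (x + t') y0)) < h) ->
    forall x, mdist (F (pt (x + t) y)) (F (pt (x + t') y)) < e.
suff [h h0 H] : exists2 h : R, 0 < h & forall y, K y -> P h y.
  by exists h => // t t' B x y Ky; exact: H.
apply: compact_near_right => // y Ky.
have [h h0 H] := close_line O0 (KO _ Ky) e3; exists h => //.
pose c : R := 2 * m.+1%:R.
have c0 : 0 < c by rewrite mulr_gt0.
pose r := d / (2 * c).
have r0 : 0 < r by rewrite divr_gt0// mulr_gt0.
apply/nbhs_ballP; exists r => // y' [_ yy'] s s0 sh Ky' t t' B x.
have E t0 : mdist (F (pt (x + t0) y)) (F (pt (x + t0) y')) < e / 3.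
  apply: Hd; try exact: tube_pt.
  apply: (le_lt_trans (@euclidean_dist_pt _ _ _ _ _ _ r (ltW r0) _ _)).
  - by move=> j; rewrite subrr normr0 ltW.
  - by move=> j; apply: ltW; exact: yy'.
  have -> : 2 * m.+1%:R * r = d / 2 by rewrite -/c /r; field; rewrite gt_eqF.
  lra.
have h1 := E t; have h2 := E t'.
have h3 : mdist (F (pt (x + t) y)) (F (pt (x + t') y)) < e / 3.
  by apply: H => x'; exact: lt_trans (B x') sh.
have h4 := metric_triangle (F (pt (x + t) y')) (F (pt (x + t) y)) (F (pt (x + t') y')).
have h5 := metric_triangle (F (pt (x + t) y)) (F (pt (x + t') y)) (F (pt (x + t') y')).
rewrite [mdist _ (F (pt (x + t) y))]metric_sym in h4; lra.
Qed.
End Propagation.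

(** * Uniform limits of shifts and almost periodicity *)

Lemma uniform_cvg_mdist (R : realType) (T : choiceType) (X : metricType R) (A : set T)
    (f : nat -> T -> X) (g : T -> X) :
  {uniform A, f @ \oo --> g} <->
  forall e : R, 0 < e -> exists N, forall k z, (N <= k)%N -> A z -> mdist (g z) (f k z) < e.
Proof.
split=> [fg e e0|H P].
  have : nbhs (g : {uniform` A -> X}) [set h | forall z, A z -> mdist (g z) (h z) < e].
    apply/uniform_nbhs; exists [set xy | ball xy.1 e xy.2]; split.
      exact: (entourage_ball X (PosNum e0)).
    by move=> h /= H z Az; have := H z Az; rewrite ballEmdist.
  by move=> /fg [N _ HN]; exists N => k z Nk Az; exact: HN.
move=> /uniform_nbhs [E [entE EP]].
have [e /= e0 He] : exists2 e : R, 0 < e & [set xy : X * X | ball xy.1 e xy.2] `<=` E.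
  by move: entE; rewrite -entourage_from_ballE => -[e e0 He]; exists e.
have [N HN] := H e e0; exists N => // k Nk; apply: EP => z Az; apply: He => /=.
by rewrite ballEmdist /=; exact: HN.
Qed.

(** The topology of C^m is that of the sup norm, and a small ball for it lies in a Euclidean one. *)
Lemma uniformly_continuous_within (R : realType) (m : nat) (X : metricType R)
    (K : set 'rV[R]_m) (G : 'rV[R[i]]_m -> X) :
  uniformly_continuous_on (tube K) G -> {within tube K, continuous G}.
Proof.
move=> uG; apply/subspace_continuousP => z Kz.
apply/(@cvg_ballP _ _ _ (within (tube K) (nbhs z))) => e e0.
have [d d0 Hd] := uG e e0.
pose c : R := 2 * m.+1%:R.
have c0 : 0 < c by rewrite mulr_gt0.
pose r := d / (2 * c).
have r0 : 0 < r by rewrite divr_gt0// mulr_gt0.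
have rC : 0 < r%:C :> R[i] by rewrite ltcR.
apply/nbhs_ballP; exists r%:C => // w [_ zw] Kw; rewrite ballEmdist /=; apply: Hd => //.
have [x [y [Ky Ez]]] := tubeP Kz; have [x' [y' [Ky' Ew]]] := tubeP Kw.
have cz j : cmod (z ord0 j - w ord0 j) < r.
  by rewrite -ltcR -cmodE; exact: (zw ord0 j).
rewrite Ez Ew; apply: (le_lt_trans (@euclidean_dist_pt _ _ _ _ _ _ r (ltW r0) _ _)).
- move=> j; have := cz j; rewrite Ez Ew !mxE => h; apply: ltW; apply: le_lt_trans h.
  exact: (Re_le_cmod ((x ord0 j +i* y ord0 j) - (x' ord0 j +i* y' ord0 j))).
- move=> j; have := cz j; rewrite Ez Ew !mxE => h; apply: ltW; apply: le_lt_trans h.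
  exact: (Im_le_cmod ((x ord0 j +i* y ord0 j) - (x' ord0 j +i* y' ord0 j))).
have -> : 2 * m.+1%:R * r = d / 2 by rewrite -/c /r; field; rewrite gt_eqF.
lra.
Qed.

Theorem mainTheorem1 (R : realType) (m : nat) (hm : (0 < m)%N)
    (Omega : set 'rV[R]_m) (hconv : convex_set Omega) (hopen : open Omega)
    (n : nat) (X : metricType R) (M : complex_atlas R n X)
    (F : 'rV[R[i]]_m -> X) (hF : holomorphic_map M (tube Omega) F)
    (hK : forall K : set 'rV[R]_m, compact K -> K `<=` Omega ->
      uniformly_continuous_on (tube K) F /\ precompact (F @` tube K))
    (hap : exists2 y' : 'rV[R]_m, Omega y' & almost_periodic_on [set y'] F) :
  almost_periodic_map M Omega F.
Proof.
split=> // K cK KO; have [uF] := hK K cK KO; rewrite precompactE => cC.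
set C := closure _ in cC.
split; first exact: uniformly_continuous_within.
(* The subsequence extracted over the single height y0 serves for all of [tube K]. *)
case: hap => y0 O0 [_ ap] t; have [s [G0 [shomo _ /uniform_cvg_mdist FG0]]] := ap t.
have CF x y : K y -> C (F (pt x y)).
  by move=> Ky; apply: subset_closure; exists (pt x y) => //; exact: tube_pt.
pose u z k := real_shift F (t (s k)) z.
have uE x y k : u (pt x y) k = F (pt (x + t (s k)) y) by rewrite /u /real_shift pt_shift.
have cau e : 0 < e -> exists N, forall z k l, tube K z -> (N <= k)%N -> (N <= l)%N ->
    mdist (u z k) (u z l) < e.
  move=> e0; have [h h0 H] := close_tube hconv hopen hF hK cK KO O0 e0.
  have h2 : 0 < h / 2 by rewrite divr_gt0.
  have [N HN] := FG0 _ h2; exists N => z k l /tubeP[x [y [Ky ->]]] Nk Nl.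
  rewrite !uE; apply: H => // x'.
  have T0 : tube [set y0] (pt x' y0) by exact: tube_pt.
  have := HN k (pt x' y0) Nk T0; have := HN l (pt x' y0) Nl T0.
  rewrite /real_shift !pt_shift => h3 h4.
  have := metric_triangle (F (pt (x' + t (s k)) y0)) (G0 (pt x' y0)) (F (pt (x' + t (s l)) y0)).
  by rewrite [mdist _ (G0 _)]metric_sym; lra.
(* Pointwise limits; off [tube K] the value is set to F z. *)
have /choice [G HG] : forall z, exists p, tube K z ->
    forall e N, (forall k l, (N <= k)%N -> (N <= l)%N -> mdist (u z k) (u z l) < e) ->
    forall k, (N <= k)%N -> mdist p (u z k) <= e.
  move=> z; have [Kz|nKz] := pselect (tube K z); last by exists (F z).
  have Cu k : C (u z k) by have [x [y [Ky ->]]] := tubeP Kz; rewrite uE; exact: CF.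
  by have [p Hp] := compact_cauchy_limit cC Cu; exists p.
have lim e : 0 < e -> exists N, forall k z, (N <= k)%N -> tube K z -> mdist (G z) (u z k) < e.
  move=> e0; have e2 : 0 < e / 2 by rewrite divr_gt0.
  have [N HN] := cau _ e2; exists N => k z Nk Kz.
  apply: (@le_lt_trans _ _ (e / 2)); last lra.
  by apply: (HG z Kz _ N) => // i j; exact: HN.
exists s, G; split => //; last by apply/uniform_cvg_mdist => e /lim.
(* Real shifts preserve Euclidean distances, so all shifts share the modulus of F and their uniform
   limit is uniformly continuous. *)
apply: uniformly_continuous_within => e e0.
have e3 : 0 < e / 3 by rewrite divr_gt0.
have [d d0 Hd] := uF _ e3; exists d => // z w Kz Kw zw.
have [N HN] := lim _ e3.
have h1 := HN N z (leqnn N) Kz; have h2 := HN N w (leqnn N) Kw.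
have h3 : mdist (u z N) (u w N) < e / 3.
  have [x [y [Ky Ez]]] := tubeP Kz; have [x' [y' [Ky' Ew]]] := tubeP Kw.
  rewrite Ez Ew !uE; apply: Hd; [exact: tube_pt|exact: tube_pt|].
  rewrite -!pt_shift /euclidean_dist -Ez -Ew; apply: le_lt_trans zw.
  rewrite le_eqVlt; apply/orP; left; apply/eqP; congr Num.sqrt; apply: eq_bigr => j _.
  by rewrite !mxE opprD addrACA subrr addr0.
have h4 := metric_triangle (G z) (u z N) (G w).
have h5 := metric_triangle (u z N) (u w N) (G w).
rewrite [mdist (u w N) (G w)]metric_sym in h5; lra.
Qed.
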